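(* Let $\beta\in VB_n$ and $\beta'\in VB_m$ ($n,m\ge 2$) be two virtual braids whose closures define the same virtual link $L$. Then $G_M(\beta)\cong G_M(\beta')$. That is, the group $G_M(\beta)$ is an invariant of the link $L=\widehat\beta$.
   Context: Notation: $a^b=b^{-1}ab$, $a^{-b}=(a^{-1})^b$, $[a,b]=a^{-1}b^{-1}ab$. Automorphisms act on the right: a product $\varphi\psi$ means first $\varphi$, then $\psi$. The virtual braid group $VB_n$ is generated by $\sigma_1,\dots,\sigma_{n-1},\rho_1,\dots,\rho_{n-1}$ with defining relations: $\sigma_i\sigma_{i+1}\sigma_i=\sigma_{i+1}\sigma_i\sigma_{i+1}$, $\rho_i\rho_{i+1}\rho_i=\rho_{i+1}\rho_i\rho_{i+1}$, $\rho_i\rho_{i+1}\sigma_i=\sigma_{i+1}\rho_i\rho_{i+1}$ for $1\le i\le n-2$; $\sigma_i\sigma_j=\sigma_j\sigma_i$, $\rho_i\rho_j=\rho_j\rho_i$, $\sigma_i\rho_j=\rho_j\sigma_i$ for $|i-j|\ge 2$; $\rho_i^2=1$. Geometrically, $\sigma_i^{\pm1}$ is a positive/negative classical crossing of strands $i$ and $i+1$ and $\rho_i$ is a virtual crossing of these strands; the product is concatenation of braid diagrams. A virtual link is an equivalence class of oriented link diagrams in the plane with classical and virtual crossings, modulo planar isotopy and the generalized (classical, virtual and mixed) Reidemeister moves; the two forbidden moves are not allowed. The closure $\widehat\beta$ of $\beta\in VB_n$ is the virtual link obtained by joining the $i$-th top endpoint of a diagram of $\beta$ to the $i$-th bottom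 endpoint in the standard way, $i=1,\dots,n$. $F_{n,2n+1}=F_n*\mathbb{Z}^{2n+1}$, where $F_n$ is free on $x_1,\dots,x_n$ and $\mathbb{Z}^{2n+1}$ is free abelian on $u_1,\dots,u_n,v_0,v_1,\dots,v_n$. The representation $\varphi_M:VB_n\to\mathrm{Aut}(F_{n,2n+1})$ is given by (unlisted generators fixed) $\varphi_M(\sigma_i): x_i\mapsto x_ix_{i+1}^{u_i}x_i^{-v_0u_{i+1}},\ x_{i+1}\mapsto x_i^{v_0},\ u_i\leftrightarrow u_{i+1},\ v_i\leftrightarrow v_{i+1}$; $\varphi_M(\rho_i): x_i\mapsto x_{i+1}^{v_i^{-1}},\ x_{i+1}\mapsto x_i^{v_{i+1}},\ u_i\leftrightarrow u_{i+1},\ v_i\leftrightarrow v_{i+1}$. For $\beta\in VB_n$ the group $G_M(\beta)$ is defined by generators $x_1,\dots,x_n,u_1,\dots,u_n,v_0,v_1,\dots,v_n$ and relations $[u_i,u_j]=[v_k,v_l]=[u_i,v_k]=1$, $x_i=\varphi_M(\beta)(x_i)$, $u_i=\varphi_M(\beta)(u_i)$, $v_i=\varphi_M(\beta)(v_i)$ for $i,j=1,\dots,n$ and $k,l=0,1,\dots,n$. *)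

(* Defs.v *)
From HB Require Import structures.
From Stdlib Require Import Relations.
From mathcomp Require Import fingroup perm all_boot zify boolp.

Set Implicit Arguments.
Unset Strict Implicit.
Unset Printing Implicit Defensive.

Local Open Scope group_scope.
Local Open Scope quotient_scope.

Section EquivalenceClosure.
Variables (T : choiceType) (r : T -> T -> Prop).

Definition closb : rel T := fun x y => `[< clos_refl_sym_trans T r x y >].

Lemma closb_refl : reflexive closb.
Proof. by move=> x; apply/asboolP/rst_refl. Qed.

Lemma closb_sym : symmetric closb.
Proof. by move=> x y; apply/asboolP/asboolP; apply: rst_sym. Qed.

Lemma closb_trans : transitive closb.
Proof. by move=> y x z /asboolP xy /asboolP yz; apply/asboolP/(rst_trans _ _ _ y). Qed.

Canonical closb_equiv := EquivRel closb closb_refl closb_sym closb_trans.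

Lemma clos_quotP x y :
  x = y %[mod_eq closb_equiv] <-> clos_refl_sym_trans T r x y.
Proof.
by split=> [/eqmodP /asboolP | h] //; apply/eqmodP/asboolP.
Qed.

End EquivalenceClosure.

(* The letter (x, false) stands for x and (x, true) for its inverse. *)
Definition word (X : Type) := seq (X * bool).
Definition letter (X : Type) (x : X) : word X := [:: (x, false)].
Definition invw (X : Type) (w : word X) : word X :=
  [seq (a.1, ~~ a.2) | a <- rev w].

Section Presentation.
Variables (X : choiceType) (R : word X -> word X -> Prop).

Inductive pres_step : word X -> word X -> Prop :=
| PresCancel p s x e : pres_step (p ++ [:: (x, e); (x, ~~ e)] ++ s) (p ++ s)
| PresRel p s l r of R l r : pres_step (p ++ l ++ s) (p ++ r ++ s).

(* The group with generators X and relations l = r whenever R l r. *)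
Definition pgroup := {eq_quot closb_equiv pres_step}.

HB.instance Definition _ : EqQuotient _ (closb_equiv pres_step) pgroup :=
  EqQuotient.on pgroup.
HB.instance Definition _ := Choice.on pgroup.

Notation eqw := (clos_refl_sym_trans (word X) pres_step).

Definition cls (w : word X) : pgroup := \pi_pgroup w.

Lemma clsP w w' : cls w = cls w' <-> eqw w w'.
Proof. exact: clos_quotP. Qed.

Lemma clsK (a : pgroup) : cls (repr a) = a.
Proof. exact: reprK. Qed.

Lemma eqw_cat p s w w' : eqw w w' -> eqw (p ++ w ++ s) (p ++ w' ++ s).
Proof.
elim=> {w w'} [w w' ww'|w|w w' _ ?|w1 w2 w3 _ ? _ ?].
- apply: rst_step; case: ww' => [q t x e|q t l r lr].
  + have -> : p ++ (q ++ [:: (x, e); (x, ~~ e)] ++ t) ++ s =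
       (p ++ q) ++ [:: (x, e); (x, ~~ e)] ++ (t ++ s) by rewrite -!catA.
    have -> : p ++ (q ++ t) ++ s = (p ++ q) ++ (t ++ s) by rewrite -!catA.
    exact: PresCancel.
  + have h u : p ++ (q ++ u ++ t) ++ s = (p ++ q) ++ u ++ (t ++ s).
      by rewrite -!catA.
    by rewrite !h; apply: PresRel.
- by apply: rst_refl.
- by apply: rst_sym.
- by apply: rst_trans; eassumption.
Qed.

Lemma eqw_cat2 w1 w1' w2 w2' :
  eqw w1 w1' -> eqw w2 w2' -> eqw (w1 ++ w2) (w1' ++ w2').
Proof.
move=> h1 h2; apply: (rst_trans _ _ _ (w1' ++ w2)).
  exact: (eqw_cat [::] w2 h1).
by have := eqw_cat w1' [::] h2; rewrite !cats0.
Qed.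

Lemma invw_cat (w w' : word X) : invw (w ++ w') = invw w' ++ invw w.
Proof. by rewrite /invw rev_cat map_cat. Qed.

Lemma invwK : involutive (@invw X).
Proof.
by move=> w; rewrite /invw -map_rev revK mapK // => -[x e] /=; rewrite negbK.
Qed.

Lemma eqw_mulV w : eqw (w ++ invw w) [::].
Proof.
elim: w => [|[x e] w IHw]; first exact: rst_refl.
rewrite -cat1s invw_cat -catA [w ++ _]catA.
apply: rst_trans (eqw_cat _ _ IHw) _; rewrite cat0s.
exact/rst_step/(PresCancel [::] [::]).
Qed.

Lemma eqw_mulVl w : eqw (invw w ++ w) [::].
Proof. by have := eqw_mulV (invw w); rewrite invwK. Qed.

Lemma eqw_inv w w' : eqw w w' -> eqw (invw w) (invw w').
Proof.
move=> h; apply: (rst_trans _ _ _ (invw w ++ w' ++ invw w')).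
  apply: rst_sym; rewrite -[X in eqw _ X]cats0.
  by apply: eqw_cat2; [apply: rst_refl | apply: eqw_mulV].
rewrite catA -[X in eqw _ X]cat0s; apply: eqw_cat2; last exact: rst_refl.
apply: rst_trans (eqw_mulVl w).
by apply: eqw_cat2; [apply: rst_refl | apply: rst_sym].
Qed.

Definition pg_one : pgroup := cls [::].
Definition pg_mul (a b : pgroup) : pgroup := cls (repr a ++ repr b).
Definition pg_inv (a : pgroup) : pgroup := cls (invw (repr a)).

Lemma eqw_repr w : eqw (repr (cls w)) w.
Proof. by apply/clsP; rewrite clsK. Qed.

Lemma pg_mulE w w' : pg_mul (cls w) (cls w') = cls (w ++ w').
Proof. by apply/clsP; apply: eqw_cat2; apply: eqw_repr. Qed.

Lemma pg_invE w : pg_inv (cls w) = cls (invw w).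
Proof. by apply/clsP; apply: eqw_inv; apply: eqw_repr. Qed.

Lemma pg_mulA : associative pg_mul.
Proof.
move=> a b c; rewrite -[a]clsK -[b]clsK -[c]clsK.
by rewrite !pg_mulE catA.
Qed.

Lemma pg_mul1 : left_id pg_one pg_mul.
Proof. by move=> a; rewrite -[a]clsK pg_mulE. Qed.

Lemma pg_mulr1 : right_id pg_one pg_mul.
Proof. by move=> a; rewrite -[a]clsK pg_mulE cats0. Qed.

Lemma pg_mulVg : left_inverse pg_one pg_inv pg_mul.
Proof.
move=> a; rewrite -[a]clsK pg_invE pg_mulE.
exact/clsP/eqw_mulVl.
Qed.

Lemma pg_mulgV : right_inverse pg_one pg_inv pg_mul.
Proof.
move=> a; rewrite -[a]clsK pg_invE pg_mulE.
exact/clsP/eqw_mulV.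
Qed.

HB.instance Definition _ :=
  isGroup.Build pgroup pg_mulA pg_mul1 pg_mulr1 pg_mulVg pg_mulgV.

Lemma piM w w' : cls (w ++ w') = cls w * cls w'.
Proof. by rewrite -pg_mulE. Qed.

Lemma piV w : cls (invw w) = (cls w)^-1.
Proof. by rewrite -pg_invE. Qed.

Lemma pi_rel l r : R l r -> cls l = cls r.
Proof.
move=> h; apply/clsP/rst_step.
by have := PresRel [::] [::] h; rewrite !cats0.
Qed.

Definition gen (x : X) : pgroup := cls (letter x).

End Presentation.

Section Lift.
Variables (X : choiceType) (G : groupType) (f : X -> G).

Definition evalw (w : word X) : G :=
  foldr (fun a g => (if a.2 then (f a.1)^-1 else f a.1) * g) 1 w.

Lemma evalw_cat w w' : evalw (w ++ w') = evalw w * evalw w'.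
Proof. by elim: w => [|a w IHw] /=; rewrite ?mul1g // IHw mulgA. Qed.

Lemma evalw_inv w : evalw (invw w) = (evalw w)^-1.
Proof.
elim: w => [|[x e] w IHw]; first by rewrite /= invg1.
rewrite -cat1s invw_cat !evalw_cat IHw invgM; congr (_ * _).
by case: e => /=; rewrite !mulg1 ?invgK.
Qed.

Variables (R : word X -> word X -> Prop).
Hypothesis fR : forall l r, R l r -> evalw l = evalw r.

Definition lift (_ : forall l r, R l r -> evalw l = evalw r) (a : pgroup R) : G :=
  evalw (repr a).

Lemma evalw_eqw w w' :
  clos_refl_sym_trans _ (pres_step R) w w' -> evalw w = evalw w'.
Proof.
elim=> {w w'} [w w' [p s x e|p s l r /fR lr]|w|w w' _ ->|w1 w2 w3 _ -> _ ->] //.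
- rewrite !evalw_cat; congr (_ * _) => /=.
  by case: e; rewrite /= !mulg1 ?mulVg ?mulgV mul1g.
- by rewrite !evalw_cat lr.
Qed.

Lemma lift_pi w : lift fR (cls R w) = evalw w.
Proof. by apply: evalw_eqw; apply: eqw_repr. Qed.

Lemma lift_gen x : lift fR (gen R x) = f x.
Proof. by rewrite lift_pi /= mulg1. Qed.

Lemma lift_div : {morph lift fR : x y / x / y}.
Proof.
move=> a b; rewrite -[a]clsK -[b]clsK -piV -piM !lift_pi.
by rewrite evalw_cat evalw_inv.
Qed.

HB.instance Definition _ := isGroupMorphism.Build (pgroup R) G (lift fR) lift_div.

End Lift.

Definition group_isomorphic (G H : groupType) : Prop :=
  exists f : {multiplicative G -> H}, bijective f.

Section Aut.
Variable G : groupType.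

Record aut := Aut {
  aut_fun :> G -> G;
  aut_inv : G -> G;
  aut_morph : {morph aut_fun : x y / x * y};
  aut_funK : cancel aut_fun aut_inv;
  aut_invK : cancel aut_inv aut_fun }.

Lemma autP (f g : aut) : f =1 g -> f = g.
Proof.
case: f => f f' fM fK f'K; case: g => g g' gM gK g'K /= /funext fg.
subst g; have e : f' = g'.
  by apply/funext => x; apply: (can_inj fK); rewrite f'K g'K.
by subst g'; congr Aut; apply: Prop_irrelevance.
Qed.

HB.instance Definition _ := gen_eqMixin aut.
HB.instance Definition _ := gen_choiceMixin aut.

Definition aut_one : aut.
Proof. by apply: (@Aut id id). Defined.

(* Automorphisms act on the right: f * g is f followed by g. *)
Definition aut_mul (f g : aut) : aut.
Proof.
apply: (@Aut (g \o f) (aut_inv f \o aut_inv g)).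
- by move=> x y /=; rewrite !aut_morph.
- by move=> x /=; rewrite !aut_funK.
- by move=> x /=; rewrite !aut_invK.
Defined.

Definition aut_invg (f : aut) : aut.
Proof.
apply: (@Aut (aut_inv f) f).
- move=> x y; apply: (can_inj (aut_funK f)).
  by rewrite aut_morph !aut_invK.
- exact: aut_invK.
- exact: aut_funK.
Defined.

Lemma aut_mulA : associative aut_mul.
Proof. by move=> f g h; apply: autP. Qed.
Lemma aut_mul1 : left_id aut_one aut_mul.
Proof. by move=> f; apply: autP. Qed.
Lemma aut_mulr1 : right_id aut_one aut_mul.
Proof. by move=> f; apply: autP. Qed.
Lemma aut_mulV : left_inverse aut_one aut_invg aut_mul.
Proof. by move=> f; apply: autP => x /=; rewrite aut_invK. Qed.
Lemma aut_mulrV : right_inverse aut_one aut_invg aut_mul.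
Proof. by move=> f; apply: autP => x /=; rewrite aut_funK. Qed.

HB.instance Definition _ :=
  isGroup.Build aut aut_mulA aut_mul1 aut_mulr1 aut_mulV aut_mulrV.

End Aut.

Section Hom.
Variables (X : choiceType) (R : word X -> word X -> Prop) (G : groupType).

Lemma cls_cons x e w :
  cls R ((x, e) :: w) = (if e then (gen R x)^-1 else gen R x) * cls R w.
Proof.
rewrite -cat1s piM; case: e => //; congr (_ * _).
by rewrite -[RHS]piV.
Qed.

Lemma hom_ext (f g : pgroup R -> G) :
  {morph f : x y / x * y} -> {morph g : x y / x * y} ->
  (forall x, f (gen R x) = g (gen R x)) -> f =1 g.
Proof.
move=> fM gM fg a; rewrite -[a]clsK; elim: (repr a) => [|[x e] w IHw].
  have h1 (h : pgroup R -> G) : {morph h : x y / x * y} -> h 1 = 1.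
    by move=> hM; apply: (@mulgI _ (h 1)); rewrite -hM !mulg1.
  by rewrite -[cls R [::]]/(1 : pgroup R) !h1.
have hV (h : pgroup R -> G) : {morph h : x y / x * y} ->
    forall y, h y^-1 = (h y)^-1.
  move=> hM y; apply: (@mulgI _ (h y)); rewrite -hM !mulgV.
  by apply: (@mulgI _ (h 1)); rewrite -hM !mulg1.
by rewrite cls_cons fM gM IHw; case: e; rewrite ?hV // fg.
Qed.

End Hom.

Inductive vbgen (n : nat) : Type := Sigma of 'I_n.-1 | Rho of 'I_n.-1.

HB.instance Definition _ n := gen_eqMixin (vbgen n).
HB.instance Definition _ n := gen_choiceMixin (vbgen n).

Notation sg i := (Sigma i, false).
Notation rh i := (Rho i, false).

Inductive vb_rel (n : nat) : word (vbgen n) -> word (vbgen n) -> Prop :=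
| VB_sss (i j : 'I_n.-1) of j = i.+1 :> nat :
    vb_rel [:: sg i; sg j; sg i] [:: sg j; sg i; sg j]
| VB_rrr (i j : 'I_n.-1) of j = i.+1 :> nat :
    vb_rel [:: rh i; rh j; rh i] [:: rh j; rh i; rh j]
| VB_rrs (i j : 'I_n.-1) of j = i.+1 :> nat :
    vb_rel [:: rh i; rh j; sg i] [:: sg j; rh i; rh j]
| VB_ss (i j : 'I_n.-1) of (i.+1 < j) || (j.+1 < i) :
    vb_rel [:: sg i; sg j] [:: sg j; sg i]
| VB_rr (i j : 'I_n.-1) of (i.+1 < j) || (j.+1 < i) :
    vb_rel [:: rh i; rh j] [:: rh j; rh i]
| VB_sr (i j : 'I_n.-1) of (i.+1 < j) || (j.+1 < i) :
    vb_rel [:: sg i; rh j] [:: rh j; sg i]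
| VB_r2 (i : 'I_n.-1) :
    vb_rel [:: rh i; rh i] [::].

Definition VB (n : nat) := pgroup (@vb_rel n).
HB.instance Definition _ n := Group.on (VB n).

(* The generators x_i, u_i, v_0, v_i; the index i of a generator is shifted to
   start from 0, as is the index of a strand or of a braid generator. *)
Inductive mgen (n : nat) : Type :=
  Mx of 'I_n | Mu of 'I_n | Mv0 | Mv of 'I_n.
Arguments Mv0 {n}.

HB.instance Definition _ n := gen_eqMixin (mgen n).
HB.instance Definition _ n := gen_choiceMixin (mgen n).

Definition is_x n (g : mgen n) : bool := if g is Mx _ then true else false.

Definition commw (X : Type) (g h : X) : word X :=
  [:: (g, true); (h, true); (g, false); (h, false)].

Inductive uv_rel (n : nat) : word (mgen n) -> word (mgen n) -> Prop :=
| UV_comm g h of ~~ is_x g & ~~ is_x h : uv_rel (commw g h) [::].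

(* The free product of the free group on the x_i with the free abelian group
   on the u_i, v_0 and the v_i. *)
Definition FM (n : nat) := pgroup (@uv_rel n).
HB.instance Definition _ n := Group.on (FM n).

Definition fx n (i : 'I_n) : FM n := gen _ (Mx i).
Definition fu n (i : 'I_n) : FM n := gen _ (Mu i).
Definition fv n (i : 'I_n) : FM n := gen _ (Mv i).
Definition fv0 n : FM n := gen _ Mv0.
Arguments fv0 {n}.

Section Endo.
Variable n : nat.
Implicit Types (f : mgen n -> FM n) (a b c d : 'I_n).

Definition uv_images f :=
  forall g h, ~~ is_x g -> ~~ is_x h -> commute (f g) (f h).

Lemma uv_imagesP f : uv_images f ->
  forall l r, uv_rel l r -> evalw f l = evalw f r.
Proof.
move=> fC l r [g h gN hN] /=; rewrite mulg1.
by rewrite (fC _ _ gN hN) mulKg mulVg.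
Qed.

Lemma gen_commute (g h : mgen n) : ~~ is_x g -> ~~ is_x h ->
  commute (gen (@uv_rel n) g) (gen (@uv_rel n) h).
Proof.
move=> gN hN; apply/commgP; apply/eqP.
have e : cls (@uv_rel n) (commw g h) = 1 by exact/pi_rel/UV_comm.
by rewrite /= !cls_cons /= mulg1 in e.
Qed.

(* The images of the generators under the automorphisms of sigma_i,
   sigma_i^-1 and rho_i, with a and b standing for i and i + 1. *)
Definition sigma_img a b (g : mgen n) : FM n :=
  match g with
  | Mx j => if j == a then fx a * fx b ^ fu a * (fx a)^-1 ^ (fv0 * fu b)
            else if j == b then fx a ^ fv0 else fx j
  | Mu j => fu (tperm a b j)
  | Mv0 => fv0
  | Mv j => fv (tperm a b j)
  end.

Definition sigmaV_img a b (g : mgen n) : FM n :=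
  match g with
  | Mx j => if j == a then fx b ^ fv0^-1
            else if j == b then
              ((fx b ^ fv0^-1)^-1 * fx a * fx b ^ fu a) ^ (fu b)^-1
            else fx j
  | Mu j => fu (tperm a b j)
  | Mv0 => fv0
  | Mv j => fv (tperm a b j)
  end.

Definition rho_img a b (g : mgen n) : FM n :=
  match g with
  | Mx j => if j == a then fx b ^ (fv a)^-1
            else if j == b then fx a ^ fv b else fx j
  | Mu j => fu (tperm a b j)
  | Mv0 => fv0
  | Mv j => fv (tperm a b j)
  end.

Lemma sigma_uv a b : uv_images (sigma_img a b).
Proof. by case=> [?|?||?] [?|?||?] // *; apply: gen_commute. Qed.
Lemma sigmaV_uv a b : uv_images (sigmaV_img a b).
Proof. by case=> [?|?||?] [?|?||?] // *; apply: gen_commute. Qed.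
Lemma rho_uv a b : uv_images (rho_img a b).
Proof. by case=> [?|?||?] [?|?||?] // *; apply: gen_commute. Qed.

Definition endo f (fC : uv_images f) : FM n -> FM n := lift (uv_imagesP fC).

Lemma endoM f (fC : uv_images f) : {morph endo fC : x y / x * y}.
Proof. exact: gmulfM. Qed.
Lemma endoV f (fC : uv_images f) : {morph endo fC : x / x^-1}.
Proof. exact: gmulfV. Qed.
Lemma endoJ f (fC : uv_images f) : {morph endo fC : x y / x ^ y}.
Proof. exact: gmulfJ. Qed.
Lemma endo_x f (fC : uv_images f) j : endo fC (fx j) = f (Mx j).
Proof. exact: lift_gen. Qed.
Lemma endo_u f (fC : uv_images f) j : endo fC (fu j) = f (Mu j).
Proof. exact: lift_gen. Qed.
Lemma endo_v f (fC : uv_images f) j : endo fC (fv j) = f (Mv j).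
Proof. exact: lift_gen. Qed.
Lemma endo_v0 f (fC : uv_images f) : endo fC fv0 = f Mv0.
Proof. exact: lift_gen. Qed.
Definition endoE := (endoM, endoV, endoJ, endo_x, endo_u, endo_v, endo_v0).

End Endo.

Section Automorphisms.
Variable n : nat.
Implicit Types (a b c d : 'I_n).

Lemma tperm_if a b j :
  tperm a b j = if j == a then b else if j == b then a else j.
Proof.
case: tpermP => [->|->|/eqP/negPf-> /eqP/negPf->] //; rewrite eqxx //.
by case: eqVneq.
Qed.

Lemma uuC a b : fu a * fu b = fu b * fu a. Proof. exact: gen_commute. Qed.
Lemma vvC a b : fv a * fv b = fv b * fv a. Proof. exact: gen_commute. Qed.
Lemma uvC a b : fu a * fv b = fv b * fu a. Proof. exact: gen_commute. Qed.
Lemma v0uC a : fv0 * fu a = fu a * fv0. Proof. exact: gen_commute. Qed.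
Lemma v0vC a : fv0 * fv a = fv a * fv0. Proof. exact: gen_commute. Qed.

Lemma FM_ext (f g : FM n -> FM n) :
  {morph f : x y / x * y} -> {morph g : x y / x * y} ->
  (forall j, f (fx j) = g (fx j)) -> (forall j, f (fu j) = g (fu j)) ->
  f fv0 = g fv0 -> (forall j, f (fv j) = g (fv j)) -> f =1 g.
Proof. by move=> fM gM ? ? ? ?; apply: hom_ext => // -[]. Qed.

Ltac flat := repeat rewrite ?conjgE ?invgM ?invgK ?mulgA ?mulgK ?mulgVK ?mulgV ?mulVg ?mul1g ?mulg1.

Lemma sigmaK a b : a != b ->
  cancel (endo (@sigma_uv n a b)) (endo (@sigmaV_uv n a b)).
Proof.
move=> ab x; have ba := ab; rewrite eq_sym in ba.
have E := (eqxx, negPf ab, negPf ba).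
move: x; apply: (FM_ext (f := fun x => endo _ (endo _ x)) (g := id)) => //;
  try by [move=> x y; rewrite !endoM | move=> j; rewrite !endoE /= tpermK | rewrite !endoE].
move=> j; rewrite endo_x /sigma_img.
case: eqVneq => [->|ja]; last case: eqVneq => [->|jb].
- rewrite !endoE /= !tperm_if !E.
  by flat.
- by rewrite !endoE /= !E -conjgM mulVg conjg1.
- by rewrite !endoE /= (negPf ja) (negPf jb).
Qed.

Lemma sigmaVK a b : a != b ->
  cancel (endo (@sigmaV_uv n a b)) (endo (@sigma_uv n a b)).
Proof.
move=> ab x; have ba := ab; rewrite eq_sym in ba.
have E := (eqxx, negPf ab, negPf ba).
move: x; apply: (FM_ext (f := fun x => endo _ (endo _ x)) (g := id)) => //;
  try by [move=> x y; rewrite !endoM | move=> j; rewrite !endoE /= tpermK | rewrite !endoE].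
move=> j; rewrite endo_x /sigmaV_img.
case: eqVneq => [->|ja]; last case: eqVneq => [->|jb].
- by rewrite !endoE /= !E -conjgM mulgV conjg1.
- rewrite !endoE /= !tperm_if !E.
  rewrite -!conjgM mulgV conjg1; by flat.
- by rewrite !endoE /= (negPf ja) (negPf jb).
Qed.

Lemma rhoK a b : a != b ->
  cancel (endo (@rho_uv n a b)) (endo (@rho_uv n a b)).
Proof.
move=> ab x; have ba := ab; rewrite eq_sym in ba.
have E := (eqxx, negPf ab, negPf ba).
move: x; apply: (FM_ext (f := fun x => endo _ (endo _ x)) (g := id)) => //;
  try by [move=> x y; rewrite !endoM | move=> j; rewrite !endoE /= tpermK | rewrite !endoE].
move=> j; rewrite endo_x /rho_img.
case: eqVneq => [->|ja]; last case: eqVneq => [->|jb].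
- by rewrite !endoE /= !tperm_if !E -conjgM mulgV conjg1.
- by rewrite !endoE /= !tperm_if !E -conjgM mulVg conjg1.
- by rewrite !endoE /= (negPf ja) (negPf jb).
Qed.

Definition sigma_aut a b (ab : a != b) : aut (FM n) :=
  Aut (endoM (@sigma_uv n a b)) (sigmaK ab) (sigmaVK ab).
Definition rho_aut a b (ab : a != b) : aut (FM n) :=
  Aut (endoM (@rho_uv n a b)) (rhoK ab) (rhoK ab).

Lemma FM_aut_ext (f g : aut (FM n)) :
  (forall j, f (fx j) = g (fx j)) -> (forall j, f (fu j) = g (fu j)) ->
  f fv0 = g fv0 -> (forall j, f (fv j) = g (fv j)) -> f = g.
Proof. by move=> *; apply/autP/FM_ext => //; apply: aut_morph. Qed.

Lemma aut_mul_fun (f g : aut (FM n)) x : (f * g) x = g (f x).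
Proof. by []. Qed.

Lemma sigma_autE a b (ab : a != b) : aut_fun (sigma_aut ab) = endo (@sigma_uv n a b).
Proof. by []. Qed.
Lemma rho_autE a b (ab : a != b) : aut_fun (rho_aut ab) = endo (@rho_uv n a b).
Proof. by []. Qed.

Ltac run E := repeat (progress rewrite ?endoE /= ?tperm_if ?E /=).

Lemma com4 (g h : FM n) : g * h = h * g ->
  (forall z, z * h * g = z * g * h) * (forall z, z * h / g = z / g * h) *
  (forall z, z / h * g = z * g / h) * (forall z, z / h / g = z / g / h).
Proof.
move=> gh; have hg : commute h g by [].
have hgV := commuteV hg; have Vhg := commute_sym (commuteV (commute_sym hg)).
have VhgV := commuteV Vhg.
split; [split; [split|]|] => z; rewrite -!mulgA; congr (_ * _).
all: by [exact: hg | exact: Vhg | symmetry; exact: hgV | exact: VhgV | exact: hgV].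
Qed.

Section Braid.
Variables a b c : 'I_n.
Hypotheses (ab : a != b) (bc : b != c) (ac : a != c).
Let E := (eqxx, negPf ab, negPf bc, negPf ac,
  etrans (eq_sym b a) (negPf ab), etrans (eq_sym c b) (negPf bc),
  etrans (eq_sym c a) (negPf ac)).
Let N := (com4 (v0uC a), com4 (v0uC b), com4 (v0uC c),
  com4 (uuC a b), com4 (uuC a c), com4 (uuC b c),
  com4 (v0vC a), com4 (v0vC b), com4 (v0vC c),
  com4 (vvC a b), com4 (vvC a c), com4 (vvC b c)).
Let N' := (com4 (uvC a a), com4 (uvC b a), com4 (uvC c a),
  com4 (uvC a b), com4 (uvC b b), com4 (uvC c b),
  com4 (uvC a c), com4 (uvC b c), com4 (uvC c c)).

Lemma ord_case3 (P : 'I_n -> Prop) : P a -> P b -> P c ->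
  (forall j, (j == a) = false -> (j == b) = false -> (j == c) = false -> P j) ->
  forall j, P j.
Proof.
move=> Pa Pb Pc Pj j.
have [->//|/negPf ja] := eqVneq j a.
have [->//|/negPf jb] := eqVneq j b.
have [->//|/negPf jc] := eqVneq j c.
exact: Pj.
Qed.

Lemma braid_sss : sigma_aut ab * sigma_aut bc * sigma_aut ab =
  sigma_aut bc * sigma_aut ab * sigma_aut bc.
Proof.
apply: FM_aut_ext; try apply: ord_case3;
  try (move=> j ja jb jc); rewrite ?aut_mul_fun ?sigma_autE ?rho_autE;
  try by [run E | repeat (progress rewrite ?endoE /= ?tperm_if ?ja ?jb ?jc)].
all: run E; flat; try done.
all: apply: (@mulgI _ (fx a)); flat; repeat (rewrite ?N ?N'; flat).
all: try done.
Qed.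

Lemma braid_rrr : rho_aut ab * rho_aut bc * rho_aut ab =
  rho_aut bc * rho_aut ab * rho_aut bc.
Proof.
apply: FM_aut_ext; try apply: ord_case3;
  try (move=> j ja jb jc); rewrite ?aut_mul_fun ?sigma_autE ?rho_autE;
  try by [run E | repeat (progress rewrite ?endoE /= ?tperm_if ?ja ?jb ?jc)].
all: run E; flat; try done.
all: apply: (@mulgI _ (fx a)); flat; repeat (rewrite ?N ?N'; flat).
all: try done.
Qed.

Lemma braid_rrs : rho_aut ab * rho_aut bc * sigma_aut ab =
  sigma_aut bc * rho_aut ab * rho_aut bc.
Proof.
apply: FM_aut_ext; try apply: ord_case3;
  try (move=> j ja jb jc); rewrite ?aut_mul_fun ?sigma_autE ?rho_autE;
  try by [run E | repeat (progress rewrite ?endoE /= ?tperm_if ?ja ?jb ?jc)].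
all: run E; flat; try done.
all: apply: (@mulgI _ (fx a)); flat; repeat (rewrite ?N ?N'; flat).
all: try done.
Qed.

End Braid.
Section Far.
Variables a b c d : 'I_n.
Hypotheses (ab : a != b) (cd : c != d).
Hypotheses (ac : a != c) (ad : a != d) (bc : b != c) (bd : b != d).
Let E := (eqxx, (negPf ab, negPf cd, negPf ac, negPf ad, negPf bc, negPf bd),
  (etrans (eq_sym b a) (negPf ab), etrans (eq_sym d c) (negPf cd),
   etrans (eq_sym c a) (negPf ac), etrans (eq_sym d a) (negPf ad),
   etrans (eq_sym c b) (negPf bc), etrans (eq_sym d b) (negPf bd))).

Lemma ord_case4 (P : 'I_n -> Prop) : P a -> P b -> P c -> P d ->
  (forall j, (j == a) = false -> (j == b) = false ->
     (j == c) = false -> (j == d) = false -> P j) ->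
  forall j, P j.
Proof.
move=> Pa Pb Pc Pd Pj j.
have [->//|/negPf ja] := eqVneq j a.
have [->//|/negPf jb] := eqVneq j b.
have [->//|/negPf jc] := eqVneq j c.
have [->//|/negPf jd] := eqVneq j d.
exact: Pj.
Qed.

Lemma far_ss : sigma_aut ab * sigma_aut cd = sigma_aut cd * sigma_aut ab.
Proof.
apply: FM_aut_ext; try apply: ord_case4;
  try (move=> j ja jb jc jd); rewrite ?aut_mul_fun ?sigma_autE ?rho_autE;
  by [run E | repeat (progress rewrite ?endoE /= ?tperm_if ?ja ?jb ?jc ?jd)].
Qed.

Lemma far_rr : rho_aut ab * rho_aut cd = rho_aut cd * rho_aut ab.
Proof.
apply: FM_aut_ext; try apply: ord_case4;
  try (move=> j ja jb jc jd); rewrite ?aut_mul_fun ?sigma_autE ?rho_autE;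
  by [run E | repeat (progress rewrite ?endoE /= ?tperm_if ?ja ?jb ?jc ?jd)].
Qed.

Lemma far_sr : sigma_aut ab * rho_aut cd = rho_aut cd * sigma_aut ab.
Proof.
apply: FM_aut_ext; try apply: ord_case4;
  try (move=> j ja jb jc jd); rewrite ?aut_mul_fun ?sigma_autE ?rho_autE;
  by [run E | repeat (progress rewrite ?endoE /= ?tperm_if ?ja ?jb ?jc ?jd)].
Qed.

End Far.

Lemma rho_aut2 a b (ab : a != b) : rho_aut ab * rho_aut ab = 1.
Proof. by apply: autP => x /=; apply: rhoK. Qed.

End Automorphisms.

Section Representation.
Variable n : nat.

Lemma lo_subproof (i : 'I_n.-1) : i < n.
Proof. exact: leq_trans (ltn_ord i) (leq_pred n). Qed.
Lemma hi_subproof (i : 'I_n.-1) : i.+1 < n.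
Proof. by case: n i => [|m] []. Qed.

Definition lo (i : 'I_n.-1) : 'I_n := Ordinal (lo_subproof i).
Definition hi (i : 'I_n.-1) : 'I_n := Ordinal (hi_subproof i).

Lemma lo_hi i : lo i != hi i.
Proof. by rewrite -val_eqE /= neq_ltn ltnSn. Qed.

Definition phi_gen (g : vbgen n) : aut (FM n) :=
  match g with
  | Sigma i => sigma_aut (lo_hi i)
  | Rho i => rho_aut (lo_hi i)
  end.

Lemma sigma_aut_irr (a b a' b' : 'I_n) (ab : a != b) (ab' : a' != b') :
  a = a' -> b = b' -> sigma_aut ab = sigma_aut ab'.
Proof. by move=> ea eb; subst a' b'; congr sigma_aut; apply: eq_irrelevance. Qed.

Lemma rho_aut_irr (a b a' b' : 'I_n) (ab : a != b) (ab' : a' != b') :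
  a = a' -> b = b' -> rho_aut ab = rho_aut ab'.
Proof. by move=> ea eb; subst a' b'; congr rho_aut; apply: eq_irrelevance. Qed.

Lemma phi_rel l r : vb_rel l r -> evalw phi_gen l = evalw phi_gen r.
Proof.
have far_neq (i j : 'I_n.-1) : (i.+1 < j) || (j.+1 < i) ->
    [/\ lo i != lo j, lo i != hi j, hi i != lo j & hi i != hi j].
  by move=> ij; rewrite -!val_eqE /=; split; lia.
case=> [i j ij|i j ij|i j ij|i j ij|i j ij|i j ij|i] /=; rewrite ?mulg1 ?mulgA.
1-3: have ac : lo i != hi j by rewrite -val_eqE /= ij; lia.
1-3: have eb : lo j = hi i by apply: val_inj.
1-3: have bc : hi i != hi j by rewrite -eb lo_hi.
1-3: rewrite ?(sigma_aut_irr (lo_hi j) bc eb) ?(rho_aut_irr (lo_hi j) bc eb) //.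
- exact: braid_sss.
- exact: braid_rrr.
- exact: braid_rrs.
- by have [*] := far_neq _ _ ij; apply: far_ss.
- by have [*] := far_neq _ _ ij; apply: far_rr.
- by have [*] := far_neq _ _ ij; apply: far_sr.
- exact: rho_aut2.
Qed.

Definition phiM : VB n -> aut (FM n) := lift phi_rel.
HB.instance Definition _ := Multiplicative.on phiM.

Lemma phiM_gen g : phiM (gen _ g) = phi_gen g.
Proof. exact: lift_gen. Qed.

End Representation.

(* Link diagrams in the plane in general position with respect to the height
   function, read from top to bottom as a sequence of elementary slices.  Each
   slice contains one local maximum, local minimum or crossing; the number
   attached to it counts the strands to its left.  The boolean of a maximum
   tells whether its left branch is oriented downwards.  [Over] (resp. [Under])
   means that the strand going from top left to bottom right is the upper
   (resp. lower) one. *)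
Inductive xtype := Over | Under | Virtual.

Definition flip (c : xtype) : xtype :=
  match c with Over => Under | Under => Over | Virtual => Virtual end.

Inductive piece := Max of bool | Min | Cross of xtype.

Definition slice : Type := (piece * nat)%type.

HB.instance Definition _ := gen_eqMixin piece.
HB.instance Definition _ := gen_choiceMixin piece.
HB.instance Definition _ := Choice.on slice.

Definition top_width (p : piece) : nat := if p is Max _ then 0 else 2.
Definition bottom_width (p : piece) : nat := if p is Min then 0 else 2.

(* The state is the list of orientations (true for downwards) of the strands
   cut by a horizontal line. *)
Definition run_slice (e : slice) (w : seq bool) : option (seq bool) :=
  let: (p, i) := e in
  match p, drop i w with
  | Max o, _ => if i <= size w then Some (take i w ++ [:: o, ~~ o & drop i w])
                else None
  | Min, a :: b :: w' => if a != b then Some (take i w ++ w') else None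
  | Cross _, a :: b :: w' => Some (take i w ++ [:: b, a & w'])
  | _, _ => None
  end.

Definition run (D : seq slice) (w : seq bool) : option (seq bool) :=
  foldl (fun s e => obind (run_slice e) s) (Some w) D.

Definition closed_diagram (D : seq slice) : bool := run D [::] == Some [::].

Record diagram := Diagram {
  slices :> seq slice;
  _ : closed_diagram slices }.

HB.instance Definition _ := [isSub for slices].
HB.instance Definition _ := [Choice of diagram by <:].

(* Crossings of the three pairs (1,2), (1,3), (2,3) of the strands of a
   triangle, numbered from left to right at the top.  Excluded are the two
   cyclic classical triangles, where no strand is the upper or the lower one,
   and the triangles with exactly one virtual crossing (forbidden moves). *)
Definition r3_type (c12 c13 c23 : xtype) : bool :=
  match c12, c13, c23 with
  | Virtual, Virtual, _ | Virtual, _, Virtual | _, Virtual, Virtual => true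
  | Virtual, _, _ | _, Virtual, _ | _, _, Virtual => false
  | Over, Under, Over | Under, Over, Under => false
  | _, _, _ => true
  end.

(* The first five moves generate planar isotopy: they are the events occurring
   in a generic isotopy, namely two slices exchanging heights, a maximum and a
   minimum cancelling, and a branch of a crossing becoming horizontal.  The other
   ones are the generalized Reidemeister moves.  Orientations are carried by the
   states, so each move stands for all its oriented versions. *)
Inductive move : seq slice -> seq slice -> Prop :=
| MoveFar p q i j :
    move [:: (p, i); (q, i + bottom_width p + j)]
         [:: (q, i + top_width p + j); (p, i)]
| MoveZigzagL o i : move [:: (Max o, i); (Min, i.+1)] [::]
| MoveZigzagR o i : move [:: (Max o, i.+1); (Min, i)] [::]
| MoveSlideMax o c i :
    move [:: (Max o, i); (Cross c, i.+1)] [:: (Max o, i.+1); (Cross (flip c), i)]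
| MoveSlideMin c i :
    move [:: (Cross c, i); (Min, i.+1)] [:: (Cross (flip c), i.+1); (Min, i)]
| MoveR1Max o c i : move [:: (Max o, i); (Cross c, i)] [:: (Max (~~ o), i)]
| MoveR1Min c i : move [:: (Cross c, i); (Min, i)] [:: (Min, i)]
| MoveR2 c i : move [:: (Cross c, i); (Cross (flip c), i)] [::]
| MoveR3 a b c i of r3_type a b c :
    move [:: (Cross a, i); (Cross b, i.+1); (Cross c, i)]
         [:: (Cross c, i.+1); (Cross b, i); (Cross a, i.+1)].

Inductive diagram_step (D D' : diagram) : Prop :=
| DiagramStep p s l r of
    move l r & slices D = p ++ l ++ s & slices D' = p ++ r ++ s.

Definition virtual_link := {eq_quot closb_equiv diagram_step}.
Definition link_of (D : diagram) : virtual_link :=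
  \pi_({eq_quot closb_equiv diagram_step}) D.

(* Braids are drawn from top to bottom with all strands oriented downwards, so
   that a positive crossing is an [Under]; the closing arcs pass to the right of
   the braid. *)
Definition braid_slice n (a : vbgen n * bool) : slice :=
  match a with
  | (Sigma i, false) => (Cross Under, val i)
  | (Sigma i, true) => (Cross Over, val i)
  | (Rho i, _) => (Cross Virtual, val i)
  end.

Definition closure_slices n (w : word (vbgen n)) : seq slice :=
  [seq (Max true, i) | i <- iota 0 n] ++ map (@braid_slice n) w ++
  [seq (Min, i) | i <- rev (iota 0 n)].

Lemma run_cat D D' w : run (D ++ D') w = obind (run D') (run D w).
Proof.
rewrite /run foldl_cat; case: (foldl _ _ D) => //=.
by elim: D' => //= e D' <-.
Qed.

Definition braid_state n : seq bool := nseq n true ++ nseq n false.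

Lemma run_max n : run [seq (Max true, i) | i <- iota 0 n] [::] = Some (braid_state n).
Proof.
elim: n => // n IHn; rewrite -addn1 iotaD map_cat run_cat IHn add0n /=.
rewrite /run /= /braid_state size_cat !size_nseq leq_addr take_size_cat ?size_nseq //.
rewrite drop_size_cat ?size_nseq // addn1.
by rewrite -[in RHS](addn1 n) nseqD -catA addn1.
Qed.

Lemma run_min n : run [seq (Min, i) | i <- rev (iota 0 n)] (braid_state n) = Some [::].
Proof.
elim: n => // n IHn; rewrite -{1}addn1 iotaD rev_cat map_cat run_cat add0n /=.
have -> : braid_state n.+1 = nseq n true ++ [:: true, false & nseq n false].
  by rewrite /braid_state -addn1 nseqD -catA addn1.
by rewrite {2}/run /= take_size_cat ?size_nseq // drop_size_cat ?size_nseq //= IHn.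
Qed.

Lemma run_braid_slice n (a : vbgen n * bool) :
  run_slice (braid_slice a) (braid_state n) = Some (braid_state n).
Proof.
have h (i : 'I_n.-1) : exists w, braid_state n = nseq i true ++ [:: true, true & w].
  have e : n = i + 2 + (n - i.+2) by have := hi_subproof i; lia.
  exists (nseq (n - i.+2) true ++ nseq n false).
  by rewrite /braid_state {1}e !nseqD -!catA.
case: a => -[i|i] [] /=; have [w ->] := h i;
by rewrite drop_size_cat ?take_size_cat ?size_nseq.
Qed.

Lemma closure_closed n (w : word (vbgen n)) : closed_diagram (closure_slices w).
Proof.
rewrite /closed_diagram /closure_slices run_cat run_max /= run_cat.
have -> : run (map (@braid_slice n) w) (braid_state n) = Some (braid_state n).
  elim: w => //= a w IHw; rewrite -cat1s run_cat /run /=.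
  by rewrite run_braid_slice /= -[RHS]IHw.
by rewrite /= run_min.
Qed.

Definition closure_diagram n (w : word (vbgen n)) : diagram :=
  Diagram (closure_closed w).

(* Independent of the representative, by braid_closureE. *)
Definition braid_closure n (b : VB n) : virtual_link :=
  link_of (closure_diagram (repr b)).

Lemma link_ofP D D' :
  link_of D = link_of D' <-> clos_refl_sym_trans diagram diagram_step D D'.
Proof. exact: clos_quotP. Qed.

Lemma braid_closureE n (w : word (vbgen n)) :
  braid_closure (cls _ w) = link_of (closure_diagram w).
Proof.
suff eqw_link w1 w2 : clos_refl_sym_trans _ (pres_step (@vb_rel n)) w1 w2 ->
    clos_refl_sym_trans diagram diagram_step
      (closure_diagram w1) (closure_diagram w2).
  by apply/link_ofP/eqw_link; apply: eqw_repr.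
elim=> {w1 w2} [w1 w2 h|w1|w1 w2 _ h|w1 w2 w3 _ h _ h']; last 3 first.
- by apply: rst_refl.
- by apply: rst_sym.
- by apply: rst_trans h h'.
have ctx p s l r : move (map (@braid_slice n) l) (map (@braid_slice n) r) ->
    clos_refl_sym_trans diagram diagram_step
      (closure_diagram (p ++ l ++ s)) (closure_diagram (p ++ r ++ s)).
  set m := [seq (Max true, i) | i <- iota 0 n].
  set e := [seq (Min, i) | i <- rev (iota 0 n)].
  set f := map (@braid_slice n).
  move=> lr; apply/rst_step/(@DiagramStep _ _ (m ++ f p) (f s ++ e) _ _ lr);
  by rewrite /= /closure_slices /f !map_cat -!catA.
have far (g k : vbgen n * bool) (i j : nat) p s c d :
    braid_slice g = (Cross c, i) -> braid_slice k = (Cross d, j) ->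
    (i.+1 < j) || (j.+1 < i) ->
    clos_refl_sym_trans diagram diagram_step
      (closure_diagram (p ++ [:: g; k] ++ s)) (closure_diagram (p ++ [:: k; g] ++ s)).
  move=> eg eh /orP[ij|ij].
  - apply: ctx; rewrite /= eg eh.
    have := MoveFar (Cross c) (Cross d) i (j - i.+2) => /=.
    by have -> : i + 2 + (j - i.+2) = j by lia.
  - apply: rst_sym; apply: ctx; rewrite /= eg eh.
    have := MoveFar (Cross d) (Cross c) j (i - j.+2) => /=.
    by have -> : j + 2 + (i - j.+2) = i by lia.
case: h => [p s x e|p s l r [i j ij|i j ij|i j ij|i j ij|i j ij|i j ij|i]].
- apply: (ctx p s [:: (x, e); (x, ~~ e)] [::]).
  case: x e => i [] /=; [exact: (MoveR2 Over)|exact: (MoveR2 Under)|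
    exact: (MoveR2 Virtual)|exact: (MoveR2 Virtual)].
- by apply: ctx; rewrite /= ij; apply: MoveR3.
- by apply: ctx; rewrite /= ij; apply: MoveR3.
- by apply: ctx; rewrite /= ij; apply: MoveR3.
- exact: (far _ _ i j).
- exact: (far _ _ i j).
- exact: (far _ _ i j).
- by apply: ctx; apply: (MoveR2 Virtual).
Qed.

(* The relations x = phi_M(b)(x), for x among the x_i, u_i, v_i with i >= 1, are
   written with all words representing the right-hand side. *)
Inductive GM_rel n (b : VB n) : word (mgen n) -> word (mgen n) -> Prop :=
| GM_comm l r of uv_rel l r : GM_rel b l r
| GM_x i w of phiM b (fx i) = cls _ w : GM_rel b (letter (Mx i)) w
| GM_u i w of phiM b (fu i) = cls _ w : GM_rel b (letter (Mu i)) w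
| GM_v i w of phiM b (fv i) = cls _ w : GM_rel b (letter (Mv i)) w.

Definition GM n (b : VB n) := pgroup (GM_rel b).
HB.instance Definition _ n (b : VB n) := Group.on (GM b).

(* Main.v *)
Require Import Defs.
From mathcomp Require Import all_boot.
From mathcomp Require Import fingroup perm.

(* Color every strand of a diagram cut into slices by elements x, u, v of a group
   H, where the u and v belong to a fixed commutative set containing v0 and are
   constant along each component.  In terms of X = x u^-1, the relations of
   phi_M(sigma_i) say that the product X_i X_{i+1} is preserved and that the over
   strand is conjugated by v0, and those of phi_M(rho_i) become conjugations by
   the v of the other strand.  Replacing X, v0 and v by their inverses on strands
   oriented upwards, the rule at a crossing is a bijection from the top labels to
   the bottom ones whose form does not depend on the orientations and is
   invariant under rotation of the crossing.  Each move then changes a coloring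
   only inside the moved part, in a unique way.  As the colorings by H of the
   closure of b are the homomorphisms from GM b to H, every diagram equivalent to
   this closure has a universal coloring by GM b, which determines GM b up to
   isomorphism. *)

Set Implicit Arguments.
Unset Strict Implicit.
Unset Printing Implicit Defensive.

Local Open Scope group_scope.

(* [dn] is the orientation; [lx] stands for x u^-1, or for its inverse on a strand
   oriented upwards, whereas [lu] and [lv] do not depend on the orientation. *)
Record label (H : Type) := Label { dn : bool; lx : H; lu : H; lv : H }.

(** * Colorings of sliced diagrams *)

Section Colorings.
Variable H : groupType.
Implicit Types (l a b : label H) (s t : seq (label H)) (ss : seq (seq (label H))).

Definition opp l := Label (~~ dn l) (lx l)^-1 (lu l) (lv l).
Definition setx l x := Label (dn l) x (lu l) (lv l).
Definition signed (o : bool) (g : H) := if o then g else g^-1.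

Lemma oppK : involutive opp.
Proof. by case=> o x u v; rewrite /opp /= negbK invgK. Qed.

Section Fixed.
Variables (v0 : H) (A : H -> Prop).

(* The over strand is conjugated by [v0], and the other bottom label is then
   forced by the conservation of the product of the two labels. *)
Definition cross (c : xtype) a b : label H * label H :=
  match c with
  | Over => let d := lx a ^ signed (dn b) v0 in
            (setx b (lx a * lx b * d^-1), setx a d)
  | Under => let d := lx b ^ (signed (dn a) v0)^-1 in
             (setx b d, setx a (d^-1 * lx a * lx b))
  | Virtual => (setx b (lx b ^ (signed (dn a) (lv a))^-1),
                setx a (lx a ^ signed (dn b) (lv b)))
  end.

Definition admissible l := A (lu l) /\ A (lv l).
Definition ok s := foldr (fun l P => admissible l /\ P) True s.

(** A relation rather than a function: a maximum creates an arbitrary admissible label and a minimum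
    imposes an equation. The branches of an arc have labels [l] and [opp l], since one of them is
    traversed upwards. *)
Fixpoint step (p : piece) (i : nat) s t : Prop :=
  match i, p with
  | 0, Max o => exists l, [/\ dn l = o, admissible l & t = [:: l, opp l & s]]
  | 0, Min => exists l, s = [:: l, opp l & t]
  | 0, Cross c => exists a b r, s = [:: a, b & r] /\
      t = [:: (cross c a b).1, (cross c a b).2 & r]
  | i'.+1, _ => exists a s' t', [/\ s = a :: s', t = a :: t' & step p i' s' t']
  end.

(** The list [ss] holds the states below the successive slices, without the initial state [s], so
    that [last s ss] is the bottom state. *)
Fixpoint cpath (D : seq slice) s ss : Prop :=
  match D, ss with
  | [::], [::] => True
  | e :: D', t :: ss' => step e.1 e.2 s t /\ cpath D' t ss'
  | _, _ => False
  end.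

Lemma cpath_size D s ss : cpath D s ss -> size ss = size D.
Proof. by elim: D s ss => [|e D IH] s [|t ss] //= [_ /IH->]. Qed.

Lemma cpath_cat D1 D2 s ss1 ss2 : size ss1 = size D1 ->
  cpath (D1 ++ D2) s (ss1 ++ ss2) <-> cpath D1 s ss1 /\ cpath D2 (last s ss1) ss2.
Proof.
elim: D1 s ss1 => [|e D1 IH] s [|t ss1] //=; first by split=> [|[]].
by case=> /IH {}IH; split=> [[h /IH[]]|[[h1 h2] h3]] //; split=> //; apply/IH.
Qed.

Lemma cpath_split D1 D2 s ss : cpath (D1 ++ D2) s ss -> exists ss1 ss2,
  [/\ ss = ss1 ++ ss2, size ss1 = size D1, cpath D1 s ss1 & cpath D2 (last s ss1) ss2].
Proof.
move=> h; have sz := cpath_size h; rewrite size_cat in sz.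
have sz1 : size (take (size D1) ss) = size D1 by rewrite size_takel // sz leq_addr.
exists (take (size D1) ss), (drop (size D1) ss); rewrite cat_take_drop; split=> //.
all: by move: h; rewrite -{1}[ss](cat_take_drop (size D1)) => /(cpath_cat _ _ _ sz1)[].
Qed.

(** At a classical crossing the over strand is recovered by the inverse conjugation and the other
    one by conservation of the product. At a virtual crossing both conjugations are undone, as [dn]
    and [lv] do not change along a strand. *)
Lemma cross_flip c a b :
  cross (flip c) (cross c a b).1 (cross c a b).2 = (a, b).
Proof.
case: c a b => - [o x u v] [o' x' u' v']; rewrite /setx /=;
  congr (Label _ _ _ _, Label _ _ _ _).
all: rewrite ?conjgK ?conjgKV //.
- by move: (_ ^ _) => d; rewrite mulgA mulgVK mulKg.
- by move: (_ ^ _) => d; rewrite !mulgA mulgV mul1g mulgK.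
Qed.

Lemma flipK : involutive flip. Proof. by case. Qed.

Lemma cross_inj c a b a' b' : (cross c a b).1 = (cross c a' b').1 ->
  (cross c a b).2 = (cross c a' b').2 -> a = a' /\ b = b'.
Proof.
move=> h1 h2; have := cross_flip c a b; rewrite h1 h2 cross_flip.
by case=> -> ->.
Qed.

Lemma okP s : ok s <-> forall l, List.In l s -> admissible l.
Proof.
elim: s => [|a s IH] /=; split=> //.
- by case=> ha /IH hs l [<-|/hs].
- move=> h; split; first by apply: h; left.
  by apply/IH => l hl; apply: h; right.
Qed.

Lemma ok_cat s t : ok (s ++ t) <-> ok s /\ ok t.
Proof.
elim: s => [|a s IH] /=; first by split=> [|[]].
by split=> [[h /IH[]]|[[h1 h2] h3]] //; split=> //; apply/IH.
Qed.

Lemma step_ok p i s t : step p i s t -> ok s -> ok t.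
Proof.
elim: i s t => [|i IH] s t.
- case: p => [o [l [_ hl ->]]|[l ->]|c [a [b [r [-> ->]]]]] /=.
  + by [].
  + by case=> _ [].
  + by case: c => -[[? ?] [[? ?] ?]] /=; do ?split.
- by case: p IH => [o|| c] IH [a [s' [t' [-> -> /IH h]]]] /= [ha /h].
Qed.

Lemma cpath_ok D s ss : cpath D s ss -> ok s -> ok (last s ss).
Proof.
elim: D s ss => [|e D IH] s [|t ss] //= [/step_ok h /IH h'] /h.
exact: h'.
Qed.

Definition orient s : seq bool := map (@dn H) s.

Lemma run_slice_cons p i (a : bool) (w : seq bool) :
  run_slice (p, i.+1) (a :: w) = omap (cons a) (run_slice (p, i) w).
Proof.
case: p => [o|| c] /=.
- by rewrite ltnS; case: leq.
- by case: (drop i w) => [|x [|y w']] //; case: ifP.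
- by case: (drop i w) => [|x [|y w']].
Qed.

Lemma step_run p i s t : step p i s t -> run_slice (p, i) (orient s) = Some (orient t).
Proof.
elim: i s t => [|i IH] s t.
- case: p => [o [l [<- _ ->]]|[l ->]|c [a [b [r [-> ->]]]]] //=.
  + by rewrite ?take0 ?drop0.
  + by rewrite ?take0 ?drop0; case: (dn l).
  + by case: c; rewrite /= ?take0 ?drop0.
- case: p IH => [o|| c] IH [a [s' [t' [-> -> /IH h]]]].
  all: by rewrite /orient [map _ _]/= run_slice_cons h.
Qed.

Lemma run_cons e D w : run (e :: D) w = obind (run D) (run_slice e w).
Proof. by rewrite -cat1s run_cat. Qed.

Lemma cpath_run D s ss : cpath D s ss -> run D (orient s) = Some (orient (last s ss)).
Proof.
elim: D s ss => [|[p i] D IH] s [|t ss] // [/step_run h /IH h'].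
by rewrite run_cons h.
Qed.

End Fixed.
End Colorings.
Definition is_max p := if p is Max _ then true else false.
Definition is_min p := if p is Min then true else false.

(** * Uniqueness of extensions of colorings *)

Section Determinism.
Variables (H : groupType) (v0 : H) (A B : H -> Prop).

(** Read downwards, only a maximum brings in a label that the state above does not determine. The
    predicates [A] and [B] may differ, since the image of a coloring under a homomorphism is later
    compared with a coloring that has its own predicate. *)
Lemma step_det p i s t t' : ~~ is_max p ->
  step v0 A p i s t -> step v0 B p i s t' -> t = t'.
Proof.
move=> hp; elim: i s t t' => [|i IH] s t t'.
- case: p hp => [//||c] _.
    by move=> /= [l ->] [l1 /(congr1 (drop 2))]; rewrite /= !drop0.
  by case=> a [b [r [-> ->]]] [a' [b' [r' [[-> -> ->] ->]]]].
- case: p hp IH => [//||c] _ IH [a [s1 [t1 [-> -> h]]]] [a' [s1' [t1' [[<- e] -> h']]]].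
  all: by rewrite -e in h'; rewrite (IH _ _ _ h h').
Qed.

Lemma step_codet p i s s' t : ~~ is_min p ->
  step v0 A p i s t -> step v0 B p i s' t -> s = s'.
Proof.
move=> hp; elim: i s s' t => [|i IH] s s' t.
- case: p hp => [o|//|c] _.
    by case=> l [_ _ ->] [l' [_ _ /(congr1 (drop 2))]]; rewrite /= !drop0.
  case=> a [b [r [-> ->]]] [a' [b' [r' [-> [h1 h2 ->]]]]].
  by have [-> ->] := cross_inj h1 h2.
- case: p hp IH => [o|//|c] _ IH [a [s1 [t1 [-> -> h]]]] [a' [s1' [t1' [-> [<- e] h']]]].
  all: by rewrite -e in h'; rewrite (IH _ _ _ h h').
Qed.

Lemma cpath_det D s ss ss' : all (fun e => ~~ is_max e.1) D ->
  cpath v0 A D s ss -> cpath v0 B D s ss' -> ss = ss'.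
Proof.
elim: D s ss ss' => [|e D IH] s [|t ss] [|t' ss'] //= /andP[eN DN] [h hss] [h' hss'].
by have et := step_det eN h h'; rewrite -et in hss' *; rewrite (IH _ _ _ DN hss hss').
Qed.

Lemma cpath_codet D s s' ss ss' : all (fun e => ~~ is_min e.1) D ->
  cpath v0 A D s ss -> cpath v0 B D s' ss' -> last s ss = last s' ss' ->
  s = s' /\ ss = ss'.
Proof.
elim: D s s' ss ss' => [|e D IH] s s' [|t ss] [|t' ss'] //= /andP[eN DN] [h hss] [h' hss'] hl.
have [et ess] := IH _ _ _ _ DN hss hss' hl; rewrite -et in h' *.
by rewrite ess (step_codet eN h h').
Qed.

End Determinism.

(** * Comparison of slice sequences with the same end states *)

Definition commutative_pred (H : groupType) (v0 : H) (A : H -> Prop) :=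
  A v0 /\ forall g h, A g -> A h -> commute g h.

(* The hypothesis on [run] excludes, when [l] is empty, the states to which [r]
   cannot be applied because of their width or orientations. *)
Definition subsumed (l r : seq slice) := forall (H : groupType) (v0 : H) A s ss,
  commutative_pred v0 A -> ok A s -> run r (orient s) <> None -> cpath v0 A l s ss ->
  exists2 ss', cpath v0 A r s ss' & last s ss' = last s ss.

(** Together with [subsumed] in both directions, this makes a move act bijectively on the colorings
    of closed diagrams. *)
Definition rigid (D : seq slice) := forall (H : groupType) (v0 : H) A B s ss ss',
  cpath v0 A D s ss -> cpath v0 B D s ss' -> last s ss = last s ss' -> ss = ss'.

Definition equivalent l r := [/\ subsumed l r, subsumed r l, rigid l & rigid r].

(** A move at position [i] is the [i]-fold shift of the same move at position 0, so that only the
    latter has to be examined. *)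
Definition shift (D : seq slice) : seq slice := [seq (e.1, e.2.+1) | e <- D].

Section Shift.
Variables (H : groupType) (v0 : H) (A : H -> Prop).

Lemma cpath_shift D a s ss : cpath v0 A (shift D) (a :: s) ss <->
  exists2 ss', ss = map (cons a) ss' & cpath v0 A D s ss'.
Proof.
elim: D s ss => [|[p i] D IH] s ss /=.
  by case: ss => [|? ?]; split=> //; [exists [::] | case=> -[]].
case: ss => [|t ss]; first by split=> // -[[]].
split.
- case=> h.
  have [t' -> ht'] : exists2 t', t = a :: t' & step v0 A p i s t'.
    by case: p h => [o||c] [a' [s' [t' [[-> ->] -> h]]]]; exists t'.
  by case/IH=> ss' -> hss'; exists (t' :: ss').
- case=> -[//|t' ss'] [-> ->] [ht' hss']; split; last by apply/IH; exists ss'.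
  by case: p ht' => [o||c]; exists a, s, t'.
Qed.

Lemma run_shift D a w : run (shift D) (a :: w) = omap (cons a) (run D w).
Proof.
elim: D w => [|[p i] D IH] w //.
by rewrite !run_cons run_slice_cons; case: run_slice => //= w'; rewrite IH.
Qed.

Lemma run_shift_nil D : D <> [::] -> run (shift D) [::] = None.
Proof. by case: D => [//|[p i] D] _; rewrite run_cons; case: p. Qed.

Lemma cpath_shift_nil D ss : cpath v0 A (shift D) [::] ss -> D = [::] /\ ss = [::].
Proof.
by case: D ss => [|[p i] D] [|t ss] //= [h _]; case: p h => [o||c] [? [? [? []]]].
Qed.

End Shift.

Lemma last_map_cons T (a : T) s ss : last (a :: s) (map (cons a) ss) = a :: last s ss.
Proof. exact: last_map. Qed.

Lemma subsumed_shift l r : subsumed l r -> subsumed (shift l) (shift r).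
Proof.
move=> lr H v0 A [|a s] ss hA sok rr.
  (* On the empty state a nonempty shifted sequence does not run, so [l] and [r] are both empty. *)
  case/cpath_shift_nil=> el ->; exists [::] => //.
  by case: r rr {lr el} => [//|e r] rr; exfalso; apply: rr; apply: run_shift_nil.
case/cpath_shift=> ss1 -> hss1.
have rr' : run r (orient s) <> None.
  by move=> rr'; apply: rr; rewrite /orient [map _ _]/= run_shift rr'.
have [ss2 h2 e2] := lr H v0 A s ss1 hA (proj2 sok) rr' hss1.
by exists (map (cons a) ss2); [apply/cpath_shift; exists ss2 | rewrite !last_map_cons e2].
Qed.

Lemma rigid_shift D : rigid D -> rigid (shift D).
Proof.
move=> h H v0 A B [|a s] ss ss'.
  by move=> /cpath_shift_nil[_ ->] /cpath_shift_nil[_ ->].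
case/cpath_shift=> ss1 -> h1 /cpath_shift[ss2 -> h2].
by rewrite !last_map_cons => -[e]; rewrite (h _ _ _ _ _ _ _ h1 h2 e).
Qed.

Lemma equivalent_shift l r : equivalent l r -> equivalent (shift l) (shift r).
Proof.
case=> *; split; by [apply: subsumed_shift | apply: rigid_shift].
Qed.

Lemma rigid_nomax D : all (fun e => ~~ is_max e.1) D -> rigid D.
Proof. by move=> h H v0 A B s ss ss' h1 h2 _; apply: cpath_det h1 h2. Qed.

Lemma rigid_nomin D : all (fun e => ~~ is_min e.1) D -> rigid D.
Proof. by move=> h H v0 A B s ss ss' h1 h2 e; have [] := cpath_codet h h1 h2 e. Qed.

Ltac group_normalize := repeat rewrite ?conjgE ?invgM ?invgK ?mulgA ?mulgK
  ?mulgVK ?mulgV ?mulVg ?mul1g ?mulg1 ?invg1.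

(** * Coloring identities of the Reidemeister moves *)

Section CrossIdentities.
Variables (H : groupType) (v0 : H).
Implicit Types a b l z f : label H.
Notation cross := (cross v0).

Lemma signedN o (g : H) : signed (~~ o) g = (signed o g)^-1.
Proof. by case: o; rewrite //= invgK. Qed.

(* A crossing turned by a quarter, its two strands exchanging their places. *)
Lemma cross_rot c a z :
  cross (flip c) z (opp (cross c a z).2) = (opp a, (cross c a z).1).
Proof.
case: c a z => - [o x u v] [o' x' u' v']; rewrite /opp /setx /= ?signedN ?invgK.
all: by congr (Label _ _ _ _, Label _ _ _ _); group_normalize.
Qed.

Lemma cross_rotV c z f :
  cross c (opp (cross (flip c) z f).1) z = ((cross (flip c) z f).2, opp f).
Proof.
case: c f z => - [o x u v] [o' x' u' v']; rewrite /opp /setx /= ?signedN ?invgK.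
all: by congr (Label _ _ _ _, Label _ _ _ _); group_normalize.
Qed.

(** At a classical crossing the conserved product is 1. At a virtual one both labels are conjugated
    by the same element, the two orientations being opposite. *)
Lemma cross_kink c l : (cross c l (opp l)).2 = opp (cross c l (opp l)).1.
Proof.
case: c l => - [o x u v]; rewrite /opp /setx /= ?signedN ?invgK ?negbK.
all: by congr (Label _ _ _ _); group_normalize.
Qed.

Lemma dn_cross1 c a b : dn (cross c a b).1 = dn b. Proof. by case: c. Qed.
Lemma dn_cross2 c a b : dn (cross c a b).2 = dn a. Proof. by case: c. Qed.

Lemma admissible_cross1 A c a b : admissible A b -> admissible A (cross c a b).1.
Proof. by case: c. Qed.
Lemma admissible_cross2 A c a b : admissible A a -> admissible A (cross c a b).2.
Proof. by case: c. Qed.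

End CrossIdentities.

Section Reidemeister3.
Variables (H : groupType) (v0 : H) (A : H -> Prop).
Hypothesis hA : commutative_pred v0 A.

(** Rewriting rules that sort commuting factors in products associated to the left, where [z] is the
    product of the factors before them. *)
Lemma commute_swaps (g h : H) : g * h = h * g ->
  (forall z, z * h * g = z * g * h) * (forall z, z * h / g = z / g * h) *
  (forall z, z / h * g = z * g / h) * (forall z, z / h / g = z / g / h).
Proof.
move=> gh; have hg : commute h g by [].
have hgV := commuteV hg; have Vhg := commute_sym (commuteV (commute_sym hg)).
have VhgV := commuteV Vhg.
split; [split; [split|]|] => z; rewrite -!mulgA; congr (_ * _).
all: by [exact: hg | exact: Vhg | symmetry; exact: hgV | exact: VhgV | exact: hgV].
Qed.

Lemma commute_signed o o' (g h : H) : commute g h -> commute (signed o g) (signed o' h).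
Proof.
move=> gh; have aux o1 (g1 h1 : H) : commute g1 h1 -> commute g1 (signed o1 h1).
  by case: o1 => //; apply: commuteV.
by apply: (aux); apply: commute_sym; apply: (aux); apply: commute_sym.
Qed.

(** With three classical crossings, the highest strand is conjugated by commuting powers of [v0],
    the conjugation of the middle strand is compatible with its passing below the highest one, and
    the lowest strand follows from the conserved product of the three labels. With virtual
    crossings, conjugation by the [lv] of a strand is compatible with the crossing of the other two,
    since it commutes with [v0] and with the other [lv]. *)
Lemma cross_r3 c12 c13 c23 a b c : r3_type c12 c13 c23 ->
  admissible A a -> admissible A b -> admissible A c ->
  let p := cross v0 c12 a b in let q := cross v0 c13 p.2 c in
  let r := cross v0 c23 p.1 q.1 in
  let q' := cross v0 c23 b c in let r' := cross v0 c13 a q'.1 in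
  let s' := cross v0 c12 r'.2 q'.2 in
  [/\ r.1 = r'.1, r.2 = s'.1 & q.2 = s'.2].
Proof.
case: hA => A0 AC; case: a b c => [oa xa ua va] [ob xb ub vb] [oc xc uc vc].
move=> r3 [/= _ ha] [/= _ hb] [/= _ hc].
have C x y o o' (hx : A x) (hy : A y) := commute_swaps (commute_signed o o' (AC x y hx hy)).
set ta := signed oa v0; set tb := signed ob v0; set tc := signed oc v0.
set wa := signed oa va; set wb := signed ob vb; set wc := signed oc vc.
have N1 := (C _ _ oa ob A0 A0, C _ _ oa oc A0 A0, C _ _ ob oc A0 A0,
  C _ _ oa ob ha hb, C _ _ oa oc ha hc, C _ _ ob oc hb hc).
have N2 := (C _ _ oa oa A0 ha, C _ _ oa ob A0 hb, C _ _ oa oc A0 hc,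
  C _ _ ob oa A0 ha, C _ _ ob ob A0 hb, C _ _ ob oc A0 hc,
  C _ _ oc oa A0 ha, C _ _ oc ob A0 hb, C _ _ oc oc A0 hc).
rewrite -/ta -/tb -/tc -/wa -/wb -/wc in N1 N2.
case: c12 r3; case: c13; case: c23 => // _.
all: rewrite /setx /= -/ta -/tb -/tc -/wa -/wb -/wc; split; congr (Label _ _ _ _).
all: move: {C} ta tb tc wa wb wc N1 N2 => ta tb tc wa wb wc N1 N2.
(* The common left factor [xa] gives the commutation rules a prefix even for the first factors. *)
all: apply: (@mulgI _ xa); group_normalize; repeat (rewrite ?N1 ?N2; group_normalize).
all: try done.
Qed.
End Reidemeister3.
Arguments step : simpl never.

(** * Invariance of colorings under the moves *)

Section StepInversion.
Variables (H : groupType) (v0 : H) (A : H -> Prop).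
Implicit Types (s t : seq (label H)) (a : label H).

Lemma stepS p i a s t : step v0 A p i.+1 (a :: s) t <->
  exists2 t', t = a :: t' & step v0 A p i s t'.
Proof.
split=> [|[t' -> h]].
  by case: p => [o||c] [a' [s' [t' [[-> ->] -> h]]]]; exists t'.
by case: p h => [o||c] h; exists a, s, t'.
Qed.

Lemma step_inS p i a s t : step v0 A p i.+1 s (a :: t) <->
  exists2 s', s = a :: s' & step v0 A p i s' t.
Proof.
split=> [|[s' -> h]].
  by case: p => [o||c] [a' [s' [t' [-> [-> ->] h]]]]; exists s'.
by case: p h => [o||c] h; exists a, s', t.
Qed.

Lemma cpath1 e s ss : cpath v0 A [:: e] s ss <->
  exists2 t, ss = [:: t] & step v0 A e.1 e.2 s t.
Proof.
split; first by case: ss => [|t [|? ?]] /= => [[]|[h _]|[_ []]]; exists t.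
by case=> t ->.
Qed.

Lemma cpath2 e f s ss : cpath v0 A [:: e; f] s ss <->
  exists t t', [/\ ss = [:: t; t'], step v0 A e.1 e.2 s t & step v0 A f.1 f.2 t t'].
Proof.
split; first by case: ss => [|t [|t' [|? ?]]] /= => [[]|[_ []]|[? [? _]]|[_ [_ []]]]; exists t, t'.
by case=> t [t' [-> ? ?]].
Qed.

Lemma cpath3 e f g s ss : cpath v0 A [:: e; f; g] s ss <->
  exists t t' t'', [/\ ss = [:: t; t'; t''], step v0 A e.1 e.2 s t,
    step v0 A f.1 f.2 t t' & step v0 A g.1 g.2 t' t''].
Proof.
split.
  case: ss => [|t [|t' [|t'' [|? ?]]]] /= => [[]|[_ []]|[_ [_ []]]|[? [? [? _]]]|[_ [_ [_ []]]]].
  by exists t, t', t''.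
by case=> t [t' [t'' [-> ? ? ?]]].
Qed.

Lemma cpath0 s ss : cpath v0 A [::] s ss <-> ss = [::].
Proof. by case: ss. Qed.

End StepInversion.

Lemma subsumed_far p q j :
  subsumed [:: (p, 0); (q, bottom_width p + j)] [:: (q, top_width p + j); (p, 0)].
Proof.
move=> H v0 A s ss _ _ _ /cpath2[t1 [t2 [-> /=]]].
case: p => [o [l [hl hl' ->]]|[l ->]|c [a [b [r [-> ->]]]]] /=.
- case/stepS=> t -> /stepS[{}t -> h2]; exists [:: t; [:: l, opp l & t]] => //=.
  by split=> //; split=> //; exists l.
- move=> h; exists [:: [:: l, opp l & t2]; t2] => //=.
  by split; [do 2!(apply/stepS; eexists; first by []) | split=> //; exists l].
- case/stepS=> t -> /stepS[{}t -> h2].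
  exists [:: [:: a, b & t]; [:: (cross v0 c a b).1, (cross v0 c a b).2 & t]] => //=.
  by split; [do 2!(apply/stepS; eexists; first by []) | split=> //; exists a, b, t].
Qed.

Lemma subsumed_farV p q j :
  subsumed [:: (q, top_width p + j); (p, 0)] [:: (p, 0); (q, bottom_width p + j)].
Proof.
move=> H v0 A s ss _ _ _ /cpath2[t1 [t2 [-> h]]] /=.
case: p h => [o h [l [hl hl' ->]]|h [l et]|c h [a [b [r [et ->]]]]] /=.
- exists [:: [:: l, opp l & s]; [:: l, opp l & t1]] => //=.
  split; first by exists l.
  by split=> //; do 2!(apply/stepS; eexists; first by []).
- rewrite et in h *; case/step_inS: h => s1 -> /step_inS[{}s1 -> h].
  by exists [:: s1; t2] => //=; split=> //; exists l.
- rewrite et in h *; case/step_inS: h => s1 -> /step_inS[{}s1 -> h].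
  exists [:: [:: (cross v0 c a b).1, (cross v0 c a b).2 & s1];
    [:: (cross v0 c a b).1, (cross v0 c a b).2 & r]] => //=.
  by split; [exists a, b, s1 | split=> //; do 2!(apply/stepS; eexists; first by [])].
Qed.

(** Only the middle state is in question. It is determined from above unless [p] is a maximum, whose
    labels can be read in the bottom state because [q] leaves them untouched. *)
Lemma rigid_far p q j : rigid [:: (p, 0); (q, bottom_width p + j)].
Proof.
have [hp|hp] := boolP (is_max p); last first.
  have [hq|hq] := boolP (is_max q); last by apply: rigid_nomax; rewrite /= hp hq.
  have [hp'|hp'] := boolP (is_min p); last first.
    by apply: rigid_nomin; rewrite /= hp'; case: q hq.
  move=> H v0 A B s ss ss' /cpath2[t1 [t2 [-> h1 h2]]] /cpath2[t1' [t2' [-> h1' h2']]] /= e.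
  by have e1 := step_det hp h1 h1'; rewrite e1 e.
case: p hp => // o _ H v0 A B s ss ss' /cpath2[t1 [t2 [-> h1 h2]]]
  /cpath2[t1' [t2' [-> h1' h2']]] /= e.
case: h1 h1' h2 h2' => l [_ _ ->] [l' [_ _ ->]].
by case/stepS=> t et _ /stepS[t' et' _]; move: e; rewrite et et' => -[-> ->].
Qed.

Lemma rigid_farV p q j : rigid [:: (q, top_width p + j); (p, 0)].
Proof.
have [hq|hq] := boolP (is_max q); last first.
  have [hp|hp] := boolP (is_max p); last by apply: rigid_nomax; rewrite /= hp hq.
  move=> H v0 A B s ss ss' /cpath2[t1 [t2 [-> h1 h2]]] /cpath2[t1' [t2' [-> h1' h2']]] /= e.
  by have e1 := step_det hq h1 h1'; rewrite e1 e.
have [hp|hp] := boolP (is_min p); last first.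
  by apply: rigid_nomin; rewrite /= hp; case: q hq.
case: p hp => // _ H v0 A B s ss ss' /cpath2[t1 [t2 [-> h1 h2]]]
  /cpath2[t1' [t2' [-> h1' h2']]] /= e.
case: h2 h1 => l -> /step_inS[s1 es _]; case: h2' h1' => l' -> /step_inS[s2 es' _].
by rewrite e; move: es'; rewrite es => -[->].
Qed.

Lemma equivalent_far p q j :
  equivalent [:: (p, 0); (q, bottom_width p + j)] [:: (q, top_width p + j); (p, 0)].
Proof.
split; [exact: subsumed_far | exact: subsumed_farV | exact: rigid_far | exact: rigid_farV].
Qed.

Lemma equivalent_zigzagL o : equivalent [:: (Max o, 0); (Min, 1%N)] [::].
Proof.
split=> H v0 A.
- move=> s ss _ _ _ /cpath2[t1 [t2 [-> [l [_ _ ->]]]]] /stepS[t -> [l' [el ->]]].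
  by exists [::] => //=; rewrite -el oppK.
- move=> s ss _ sok sr /cpath0->.
  case: s sok sr => [//|a s] [ha _] sr.
  (* The zigzag runs only on a strand with the orientation of the left branch of the maximum. *)
  have ea : dn a = o by move: sr; rewrite /run /=; case: (dn a); case: o.
  exists [:: [:: a, opp a, a & s]; a :: s] => //; apply/cpath2.
  exists [:: a, opp a, a & s], (a :: s); split=> //; first by exists a.
  by apply/stepS; exists s => //; exists (opp a); rewrite oppK.
- move=> B s ss ss' /cpath2[t1 [t2 [-> [l [_ _ ->]]]]] /stepS[t -> [l' [el es]]].
  case/cpath2=> [t1' [t2' [-> [m [_ _ ->]]]]] /stepS[t' -> [m' [em es']]] /= e.
  by case: e => -> ->.
- by move=> B s ss ss' /cpath0-> /cpath0->.
Qed.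

Lemma equivalent_zigzagR o : equivalent [:: (Max o, 1%N); (Min, 0)] [::].
Proof.
split=> H v0 A.
- move=> s ss _ _ _ /cpath2[t1 [t2 [-> [a [s' [t' [-> ->]]]]]]].
  case=> l [_ _ ->] [l' [-> -> <-]].
  by exists [::] => //=; rewrite oppK.
- move=> s ss _ sok sr /cpath0->.
  case: s sok sr => [//|a s] [ha _] sr.
  have ea : ~~ dn a = o.
    by move: sr; rewrite /run /= take0; case: (dn a); case: o.
  exists [:: [:: a, opp a, a & s]; a :: s] => //; apply/cpath2.
  exists [:: a, opp a, a & s], (a :: s); split=> //; last by exists a.
  by apply/stepS; eexists; [by [] | exists (opp a); rewrite oppK; split].
- move=> B s ss ss' /cpath2[t1 [t2 [-> [a [s' [t' [-> ->]]]]]]].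
  case=> l [_ _ ->] [l' [-> -> <-]].
  case/cpath2=> [t1' [t2' [-> [a' [s2 [t3 [[<- <-] ->]]]]]]].
  by case=> m [_ _ ->] [m' [-> -> <-]].
- by move=> B s ss ss' /cpath0-> /cpath0->.
Qed.

(** The rule at a crossing is invariant under a quarter turn, by [cross_rot] and [cross_rotV]. After
    the slide the maximum carries the label that its strand had past the crossing. *)
Lemma equivalent_slide_max o c :
  equivalent [:: (Max o, 0); (Cross c, 1%N)] [:: (Max o, 1%N); (Cross (flip c), 0)].
Proof.
split; last 2 first; try by apply: rigid_nomin.
- move=> H v0 A s ss _ _ _ /cpath2[t1 [t2 [-> [l [hl al ->]]]]].
  case/stepS=> t -> [a [z [r [[<- ->] ->]]]].
  set x := cross v0 c (opp l) z.
  exists [:: [:: z, opp x.2, x.2 & r]; [:: l, x.1, x.2 & r]] => //.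
  apply/cpath2; do 2!eexists; split; first by [].
    apply/stepS; eexists; first by [].
    exists (opp x.2); rewrite oppK /= dn_cross2 /= negbK; split=> //.
    exact: (@admissible_cross2 _ _ A).
  by exists z, (opp x.2), (x.2 :: r); rewrite cross_rot oppK.
- move=> H v0 A s ss _ _ _ /cpath2[t1 [t2 [-> ]]].
  case=> z [r [t [-> -> [l [hl al ->]]]]] [a [b [r' [[<- <- <-] ->]]]].
  set x := cross v0 (flip c) z l.
  exists [:: [:: x.1, opp x.1, z & r]; [:: x.1, x.2, opp l & r]] => //.
  apply/cpath2; do 2!eexists; split; first by [].
    exists x.1; rewrite dn_cross1; split=> //.
    exact: (@admissible_cross1 _ _ A).
  apply/stepS; eexists; first by [].
  by exists (opp x.1), z, r; rewrite cross_rotV.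
Qed.

Lemma equivalent_slide_min c :
  equivalent [:: (Cross c, 0); (Min, 1%N)] [:: (Cross (flip c), 1%N); (Min, 0)].
Proof.
split; last 2 first; try by apply: rigid_nomax.
- move=> H v0 A s ss _ _ _ /cpath2[t1 [t2 [-> [a [b [r [-> ->]]]]]]].
  case/stepS=> t -> [l [<- ->]].
  set x := cross v0 c a b.
  have e := cross_rot v0 c a b; rewrite -/x in e.
  exists [:: [:: a, opp a, x.1 & t]; x.1 :: t] => //.
  apply/cpath2; do 2!eexists; split; first by [].
    apply/stepS; eexists; first by [].
    by exists b, (opp x.2), t; rewrite e.
  by exists a.
- move=> H v0 A s ss _ _ _ /cpath2[t1 [t2 [-> ]]].
  case=> a [r [t [-> -> [b [d [r' [-> ->]]]]]]] [l [<- e <-]].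
  set x := cross v0 (flip c) b d in e *.
  have e' := cross_rotV v0 c b d; rewrite -/x e oppK in e'.
  exists [:: [:: x.2, opp d, d & r']; x.2 :: r'] => //.
  apply/cpath2; do 2!eexists; split; first by [].
    by exists a, b, (d :: r'); rewrite e'.
  by apply/stepS; eexists; [by [] | exists (opp d); rewrite oppK].
Qed.

Lemma equivalent_r1_max o c :
  equivalent [:: (Max o, 0); (Cross c, 0)] [:: (Max (~~ o), 0)].
Proof.
split; last 2 first; try by apply: rigid_nomin.
- move=> H v0 A s ss _ _ _ /cpath2[t1 [t2 [-> [l [hl al ->]]]]].
  case=> a [b [r [[<- <- <-] ->]]].
  set x := cross v0 c l (opp l).
  exists [:: [:: x.1, x.2 & s]] => //; apply/cpath1; eexists; first by [].
  exists x.1; split; [by rewrite dn_cross1 /= hl | | by rewrite -cross_kink].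
  exact: (@admissible_cross1 _ _ A).
- move=> H v0 A s ss _ _ _ /cpath1[t -> [l [hl al ->]]].
  (* The label of the maximum above the crossing is found by undoing the crossing. *)
  set x := cross v0 (flip c) l (opp l).
  exists [:: [:: x.1, opp x.1 & s]; [:: l, opp l & s]] => //.
  apply/cpath2; do 2!eexists; split; first by [].
    exists x.1; rewrite dn_cross1 /= hl negbK; split=> //.
    exact: (@admissible_cross1 _ _ A).
  exists x.1, (opp x.1), s; rewrite -cross_kink -/x.
  by have := cross_flip v0 (flip c) l (opp l); rewrite -/x flipK => ->.
Qed.

Lemma equivalent_r1_min c : equivalent [:: (Cross c, 0); (Min, 0)] [:: (Min, 0)].
Proof.
split; last 2 first; try by apply: rigid_nomax.
- move=> H v0 A s ss _ _ _ /cpath2[t1 [t2 [-> [a [b [r [-> ->]]]]]]].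
  case=> l [e1 e2 ->]; exists [:: t2] => //; apply/cpath1; exists t2 => //.
  have := cross_flip v0 c a b; rewrite e2 e1 => e.
  by have := cross_kink v0 (flip c) l; rewrite e /= => ->; exists a.
- move=> H v0 A s ss _ _ _ /cpath1[t -> [l ->]].
  set x := cross v0 c l (opp l).
  exists [:: [:: x.1, opp x.1 & t]; t] => //.
  apply/cpath2; do 2!eexists; split; first by [].
    by exists l, (opp l), t; rewrite -cross_kink.
  by exists x.1.
Qed.

Lemma equivalent_r2 c : equivalent [:: (Cross c, 0); (Cross (flip c), 0)] [::].
Proof.
split; last 2 first; try by apply: rigid_nomax.
- move=> H v0 A s ss _ _ _ /cpath2[t1 [t2 [-> [a [b [r [-> ->]]]]]]].
  case=> a' [b' [r' [[<- <- <-] ->]]].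
  by exists [::] => //=; rewrite cross_flip.
(* The crossings do not run on fewer than two strands. *)
- move=> H v0 A [|a [|b s]] ss _ _ // _ /cpath0->.
  eexists; first by apply/cpath2; do 2!eexists; split; [by []| |];
    do 3!eexists; split.
  by rewrite /= cross_flip.
Qed.

Lemma equivalent_r3 a b c : r3_type a b c ->
  equivalent [:: (Cross a, 0); (Cross b, 1%N); (Cross c, 0)]
             [:: (Cross c, 1%N); (Cross b, 0); (Cross a, 1%N)].
Proof.
move=> abc; split; last 2 first; try by apply: rigid_nomax.
- move=> H v0 A s ss hA sok _ /cpath3[t1 [t2 [t3 [-> ]]]].
  case=> x [y [r [es ->]]] /stepS[t -> [y' [z [r' [[<- er] ->]]]]].
  case=> x' [y'' [r'' [[<- <- <-] ->]]].
  rewrite es er in sok *; case: sok => hx [hy [hz _]].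
  have /= [e1 e2 e3] := cross_r3 hA abc hx hy hz.
  set q := cross v0 c y z; set p := cross v0 b x q.1; set u := cross v0 a p.2 q.2.
  exists [:: [:: x, q.1, q.2 & r']; [:: p.1, p.2, q.2 & r'];
    [:: p.1, u.1, u.2 & r']]; last by rewrite /= e1 e2 e3.
  split; [|split; [|split=> //]].
  - by apply/stepS; eexists; [by [] | exists y, z, r'].
  - by exists x, q.1, (q.2 :: r').
  - by apply/stepS; eexists; [by [] | exists p.2, q.2, r'].
- move=> H v0 A s ss hA sok _ /cpath3[t1 [t2 [t3 [-> ]]]].
  case=> x [s' [t' [es -> [y [z [r [er ->]]]]]]] [x' [y' [r' [[<- <- <-] ->]]]].
  case/stepS=> t -> [y'' [z' [r'' [[<- <- <-] ->]]]].
  rewrite es er in sok *; case: sok => hx [hy [hz _]].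
  have /= [e1 e2 e3] := cross_r3 hA abc hx hy hz.
  set p := cross v0 a x y; set q := cross v0 b p.2 z; set u := cross v0 c p.1 q.1.
  exists [:: [:: p.1, p.2, z & r]; [:: p.1, q.1, q.2 & r];
    [:: u.1, u.2, q.2 & r]]; last by rewrite /= e1 e2 e3.
  split; [|split; [|split=> //]].
  - by exists x, y, (z :: r).
  - by apply/stepS; eexists; [by [] | exists p.2, z, r].
  - by exists p.1, q.1, (q.2 :: r).
Qed.

Lemma move_equivalent l r : move l r -> equivalent l r.
Proof.
case=> [p q i j|o i|o i|o c i|c i|o c i|c i|c i|a b c i abc].
(* In each move, raising [i] by one is [shift] up to conversion. *)
all: elim: i => [|i IH]; last exact: (equivalent_shift IH).
- exact: equivalent_far.
- exact: equivalent_zigzagL.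
- exact: equivalent_zigzagR.
- exact: equivalent_slide_max.
- exact: equivalent_slide_min.
- exact: equivalent_r1_max.
- exact: equivalent_r1_min.
- exact: equivalent_r2.
- exact: equivalent_r3.
Qed.

(** * Universal colorings *)

Section GroupMorphism.
Variables (G H : groupType) (f : G -> H).
Hypothesis fM : {morph f : x y / x * y}.

Lemma hom_inv : {morph f : x / x^-1}.
Proof.
have f1 : f 1 = 1 by apply: (@mulgI _ (f 1)); rewrite -fM !mulg1.
by move=> x; apply: (@mulgI _ (f x)); rewrite -fM !mulgV.
Qed.

Lemma hom_conj : {morph f : x y / x ^ y}.
Proof. by move=> x y; rewrite !conjgE !fM hom_inv. Qed.

End GroupMorphism.

Section LabelMap.
Variables (G H : groupType) (f : {multiplicative G -> H}).
Implicit Types (l a b : label G) (s t : seq (label G)).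

Definition lmap l := Label (dn l) (f (lx l)) (f (lu l)) (f (lv l)).

Lemma signed_map o g : f (signed o g) = signed o (f g).
Proof. by case: o => //=; rewrite (hom_inv (@gmulfM _ _ f)). Qed.

Lemma lmap_opp l : lmap (opp l) = opp (lmap l).
Proof. by rewrite /lmap /opp /= (hom_inv (@gmulfM _ _ f)). Qed.

Lemma lmap_cross v0 c a b :
  cross (f v0) c (lmap a) (lmap b) = (lmap (cross v0 c a b).1, lmap (cross v0 c a b).2).
Proof.
have V := hom_inv (@gmulfM _ _ f); have J := hom_conj (@gmulfM _ _ f).
by case: c => /=; rewrite /lmap /setx /= -!signed_map -?V -?J -?V -?gmulfM.
Qed.

Variables (v0 : G) (A : G -> Prop) (B : H -> Prop).
Hypothesis fAB : forall g, A g -> B (f g).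

Lemma step_lmap p i s t :
  step v0 A p i s t -> step (f v0) B p i (map lmap s) (map lmap t).
Proof.
elim: i s t => [|i IH] s t.
- case: p => [o [l [hl [au av] ->]]|[l ->]|c [a [b [r [-> ->]]]]].
  + exists (lmap l); rewrite /= lmap_opp; split=> //.
    by split; apply: fAB.
  + by exists (lmap l); rewrite /= lmap_opp.
  + by exists (lmap a), (lmap b), (map lmap r); rewrite lmap_cross.
- by case: p IH => [o||c] IH [a [s' [t' [-> -> /IH h]]]]; apply/stepS; exists (map lmap t').
Qed.

Lemma cpath_lmap D s ss :
  cpath v0 A D s ss -> cpath (f v0) B D (map lmap s) (map (map lmap) ss).
Proof. by elim: D s ss => [|e D IH] s [|t ss] //= [/step_lmap ? /IH]. Qed.

End LabelMap.

Definition coloring D (H : groupType) (v0 : H) A ss :=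
  commutative_pred v0 A /\ cpath v0 A D [::] ss.

(** An initial object among the groups with a coloring of [D]; morphisms have to respect only [v0]
    and the labels. *)
Definition universal D (G : groupType) (v0 : G) A ss :=
  coloring D v0 A ss /\
  forall (H : groupType) (w0 : H) B ss', coloring D w0 B ss' ->
  exists f : {multiplicative G -> H},
    [/\ f v0 = w0, map (map (lmap f)) ss = ss' &
     forall g : {multiplicative G -> H},
       g v0 = w0 -> map (map (lmap g)) ss = ss' -> f =1 g].

Definition presents D (G : groupType) := exists v0 A ss, @universal D G v0 A ss.

(** Initial objects are unique: both composites of the two induced morphisms preserve a universal
    coloring, as does the identity. *)
Lemma presents_iso D (G G' : groupType) :
  presents D G -> presents D G' -> group_isomorphic G G'.
Proof.
have lmap_id (K : groupType) (h : {multiplicative K -> K}) (ss : seq (seq (label K))) :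
    h =1 id -> map (map (lmap h)) ss = ss.
  by move=> hid; rewrite -[RHS]map_id; apply: eq_map => s; rewrite -[RHS]map_id;
     apply: eq_map => -[o x u v]; rewrite /lmap /= !hid.
have lmap_comp (K L M : groupType) (h : {multiplicative K -> L})
    (k : {multiplicative L -> M}) (ss : seq (seq (label K))) :
    map (map (lmap (k \o h))) ss = map (map (lmap k)) (map (map (lmap h)) ss).
  by rewrite -map_comp; apply: eq_map => s; rewrite /= -map_comp.
move=> [v0 [A [ss [cG uG]]]] [w0 [B [ss' [cG' uG']]]].
have [f [f0 fs _]] := uG _ _ _ _ cG'; have [g [g0 gs _]] := uG' _ _ _ _ cG.
exists f; exists g => x.
  have [h [_ _ hu]] := uG _ _ _ _ cG.
  have e1 : h x = g (f x).
    by apply: (hu (g \o f)); [rewrite /= f0 g0 | rewrite lmap_comp fs gs].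
  by rewrite -e1; apply: (hu idfun) => //; apply: lmap_id.
have [h [_ _ hu]] := uG' _ _ _ _ cG'.
have e1 : h x = f (g x).
  by apply: (hu (f \o g)); [rewrite /= g0 f0 | rewrite lmap_comp gs fs].
by rewrite -e1; apply: (hu idfun) => //; apply: lmap_id.
Qed.

(** * Replacement of a part of a colored diagram *)

Section LocalChange.
Variables (p l r s : seq slice).

(** Stated on bare lists, without any group, so that the relation is preserved when a homomorphism
    is applied to all labels. *)
Definition replaced (T : Type) (ss ss' : seq (seq T)) :=
  exists ss1 ss2 ss2' ss3,
  [/\ ss = ss1 ++ ss2 ++ ss3, ss' = ss1 ++ ss2' ++ ss3, size ss1 = size p &
   [/\ size ss2 = size l, size ss2' = size r &
    last (last [::] ss1) ss2 = last (last [::] ss1) ss2']].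

Lemma replaced_map (T U : Type) (f : T -> U) ss ss' :
  replaced ss ss' -> replaced (map (map f) ss) (map (map f) ss').
Proof.
case=> ss1 [ss2 [ss2' [ss3 [-> -> h1 [h2 h3 h4]]]]].
exists (map (map f) ss1), (map (map f) ss2), (map (map f) ss2'), (map (map f) ss3).
rewrite !map_cat !size_map; split=> //; split=> //.
by rewrite (last_map (map f) ss1 [::]) !last_map h4.
Qed.

(** The run of the new diagram provides the hypothesis on [run] in [subsumed], and the unchanged
    bottom state lets the rest of the coloring be kept. *)
Lemma coloring_replace (H : groupType) (v0 : H) A ss : subsumed l r ->
  run (p ++ r ++ s) [::] <> None -> coloring (p ++ l ++ s) v0 A ss ->
  exists2 ss', coloring (p ++ r ++ s) v0 A ss' & replaced ss ss'.
Proof.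
move=> lr hr [hA /cpath_split[ss1 [ss4 [-> e1 h1]]]].
case/cpath_split=> [ss2 [ss3 [-> e2 h2 h3]]].
have sok : ok A (last [::] ss1) by apply: (cpath_ok h1).
have hrun : run r (orient (last [::] ss1)) <> None.
  by move=> e; apply: hr; rewrite run_cat (cpath_run h1 : run p [::] = _) /= run_cat e.
have [ss2' h2' e] := lr _ _ _ _ _ hA sok hrun h2.
have sz := cpath_size h2'.
exists (ss1 ++ ss2' ++ ss3); last by exists ss1, ss2, ss2', ss3.
split=> //; apply/cpath_cat => //; split=> //; apply/cpath_cat => //; split=> //.
by rewrite e.
Qed.

(** Outside the replaced part both colorings agree with [ss]; inside it they have the same end
    states, and [rigid] applies. *)
Lemma replaced_uniq (H : groupType) (v0 : H) A B ss ss' ss'' : rigid r ->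
  cpath v0 A (p ++ r ++ s) [::] ss' -> cpath v0 B (p ++ r ++ s) [::] ss'' ->
  replaced ss ss' -> replaced ss ss'' -> ss' = ss''.
Proof.
move=> rr hA hB [s1 [s2 [s2' [s3 [e0 e' e1 [e2 e2' e3]]]]]].
case=> [t1 [t2 [t2' [t3 [f0 f' f1 [f2 f2' f3]]]]]].
have [es1 [es2 es3]] : s1 = t1 /\ s2 = t2 /\ s3 = t3.
  have sz1 : size s1 = size t1 by rewrite e1.
  have sz2 : size s2 = size t2 by rewrite e2.
  have := congr1 (take (size s1)) e0; rewrite {1}f0 {1}sz1 !take_size_cat // => E1.
  have := congr1 (drop (size s1)) e0; rewrite {1}f0 {1}sz1 !drop_size_cat // => E.
  have := congr1 (take (size s2)) E; rewrite {1}sz2 !take_size_cat // => E2.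
  by have := congr1 (drop (size s2)) E; rewrite {1}sz2 !drop_size_cat // => E3.
subst t1 t2 t3; move: hA hB; rewrite e' f'.
case/(cpath_cat _ _ _ _ _ e1)=> _ /(cpath_cat _ _ _ _ _ e2')[hA _].
case/(cpath_cat _ _ _ _ _ e1)=> _ /(cpath_cat _ _ _ _ _ f2')[hB _].
by rewrite (rr _ _ _ _ _ _ _ hA hB) -?e3.
Qed.

End LocalChange.

Lemma replaced_sym p l r T (ss ss' : seq (seq T)) :
  replaced p l r ss ss' -> replaced p r l ss' ss.
Proof.
case=> ss1 [ss2 [ss2' [ss3 [-> -> h1 [h2 h3 h4]]]]].
by exists ss1, ss2', ss2, ss3.
Qed.

(** The universal coloring [c] is carried over to [c'], and any coloring [d'] back to [d]. The
    morphism taking [c] to [d] takes [c'] to [d'], since the image of [c'] and [d'] both replace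
    [d]; its uniqueness is obtained in the same way. *)
Lemma presents_replace p l r s (G : groupType) : equivalent l r ->
  run (p ++ l ++ s) [::] <> None -> run (p ++ r ++ s) [::] <> None ->
  presents (p ++ l ++ s) G -> presents (p ++ r ++ s) G.
Proof.
case=> lr rl rigl rigr hl hr [v0 [A [c [cc cu]]]].
have [c' cc' rcc'] := coloring_replace lr hr cc.
exists v0, A, c'; split=> // H w0 B d' cd'.
have [d cd /replaced_sym rdd'] := coloring_replace rl hl cd'.
have [f [f0 fc fu]] := cu _ _ _ _ cd; exists f.
(* A homomorphism need not send [A] into [B], hence the trivial predicate for the image. *)
have map_c (g : {multiplicative G -> H}) D ss : coloring D v0 A ss ->
    cpath (g v0) (fun _ => True) D [::] (map (map (lmap g)) ss).
  by case=> _ /(@cpath_lmap _ _ g _ _ (fun _ => True)); apply.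
split=> //.
- apply: (replaced_uniq (v0 := w0) (A := fun _ => True) (B := B) rigr _ _ _ rdd').
  + by rewrite -f0; apply: map_c cc'.
  + by case: cd'.
  + by rewrite -fc; apply: replaced_map.
- move=> g g0 gc; apply: fu => //.
  apply: (replaced_uniq (v0 := w0) (A := fun _ => True) (B := B) rigl _ _ _ (replaced_sym rdd')).
  + by rewrite -g0; apply: map_c cc.
  + by case: cd.
  + by rewrite -gc; apply/replaced_map/replaced_sym.
Qed.

Lemma presents_link (D D' : diagram) (G : groupType) :
  link_of D = link_of D' -> presents D G -> presents D' G.
Proof.
have closedN (E : diagram) : run E [::] <> None by case: E => E /= /eqP ->.
have main (E E' : diagram) : diagram_step E E' -> presents E G <-> presents E' G.
  case=> p s l r /move_equivalent lr eE eE'.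
  have hE := closedN E; have hE' := closedN E'; rewrite eE eE' in hE hE' *.
  by split; apply: presents_replace => //; case: lr.
move/link_ofP => h; suff: presents D G <-> presents D' G by case.
elim: h => [? ? /main //|//|? ? _ [? ?] //|? ? ? _ [? ?] _ [? ?]]; by split; auto.
Qed.

(** * Colorings of closures of braids *)

Section Frames.
Variables (H : groupType) (v0 : H) (A : H -> Prop).
Implicit Types (l : label H) (s t e : seq (label H)) (ss : seq (seq (label H))).

Lemma step_frame p s1 s2 t : step v0 A p (size s1) (s1 ++ s2) t <->
  exists2 t2, t = s1 ++ t2 & step v0 A p 0 s2 t2.
Proof.
elim: s1 t => [|a s1 IH] t /=; first by split=> [h|[t2 -> //]]; exists t.
split=> [/stepS[t' -> /IH[t2 -> h]]|[t2 -> h]]; first by exists t2.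
by apply/stepS; exists (s1 ++ t2) => //; apply/IH; exists t2.
Qed.

Lemma step_cat p i s t r : ~~ is_max p -> step v0 A p i s t ->
  step v0 A p i (s ++ r) (t ++ r).
Proof.
move=> hp; elim: i s t => [|i IH] s t.
  case: p hp => [//||c] _; first by case=> l ->; exists l.
  by case=> a [b [s' [-> ->]]]; exists a, b, (s' ++ r).
case: p hp IH => [//||c] _ IH [a [s' [t' [-> -> /IH h]]]].
all: by apply/stepS; exists (t' ++ r).
Qed.

Lemma cpath_catr D s ss r : all (fun e : slice => ~~ is_max e.1) D ->
  cpath v0 A D s ss -> cpath v0 A D (s ++ r) (map (cat^~ r) ss).
Proof.
elim: D s ss => [|e D IH] s [|t ss] //= /andP[eN DN] [h /IH h'].
by split; [apply: step_cat | apply: h'].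
Qed.

Lemma step_flip c i s t :
  step v0 A (Cross c) i s t -> step v0 A (Cross (flip c)) i t s.
Proof.
elim: i s t => [|i IH] s t.
  case=> a [b [r [-> ->]]].
  by exists (cross v0 c a b).1, (cross v0 c a b).2, r; rewrite cross_flip.
by case=> a [s' [t' [-> -> /IH h]]]; apply/stepS; exists s'.
Qed.

Lemma step_cross_nth c i s t d : i.+1 < size s -> size s = size t ->
  cross v0 c (nth d s i) (nth d s i.+1) = (nth d t i, nth d t i.+1) ->
  (forall j, j != i -> j != i.+1 -> nth d s j = nth d t j) ->
  step v0 A (Cross c) i s t.
Proof.
elim: i s t => [|i IH] [|a s] [|a' t] //= si [st] e hj; last first.
  have -> : a = a' := hj 0 isT isT.
  apply/stepS; exists t => //; apply: IH => // j j1 j2.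
  by apply: (hj j.+1).
case: s t si st e hj => [|b s] [|b' t] //= _ [st] e hj.
exists a, b, s; rewrite e; split=> //; congr [:: _, _ & _].
by apply: (@eq_from_nth _ d) => [|j _]; [| symmetry; apply: (hj j.+2)].
Qed.

(** A horizontal section of a closure: the braid strands [e], then the closing arcs in reverse order
    and with reverse orientations. The labels [e'] of the arcs are separate from [e], because the
    two may differ below the braid. *)
Definition nest e e' := e ++ rev (map (@opp H) e').

Lemma nest_rcons e l e' l' :
  nest (rcons e l) (rcons e' l') = e ++ [:: l, opp l' & rev (map (@opp H) e')].
Proof. by rewrite /nest map_rcons rev_rcons cat_rcons. Qed.

(** Each maximum is placed inside the preceding ones, so its label is appended at the end of [e]. *)
Lemma maxs_cpathP n t :
  (exists2 ss, cpath v0 A [seq (Max true, i) | i <- iota 0 n] [::] ss & last [::] ss = t)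
  <-> exists e, [/\ size e = n, all (@dn H) e, ok A e & t = nest e e].
Proof.
elim: n t => [|n IH] t; rewrite -?(addn1 n) ?iotaD ?map_cat.
  split; first by case=> -[|? ?] // _ <-; exists [::].
  by case=> -[|? ?] [] // _ _ _ ->; exists [::].
split.
  case=> ss /cpath_split[ss1 [ss2 [-> _ h1]]] /cpath1[t1 -> /= h] <-.
  have [e [en e1 e2 et]] : exists e, [/\ size e = n, all (@dn H) e, ok A e &
    last [::] ss1 = nest e e] by apply/IH; exists ss1.
  move: h; rewrite et add0n -en => /step_frame[t2 -> [l [l1 l2 ->]]].
  exists (rcons e l); rewrite size_rcons all_rcons l1 e1 nest_rcons last_cat /= addn1.
  by split=> //; rewrite -cats1; apply/ok_cat.
case; case/lastP => [|e l] []; rewrite ?addn1 ?size_rcons // => -[en].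
rewrite all_rcons -cats1 => /andP[hl he] /ok_cat[oke [okl _]] ->.
have [ss h1 h2] : exists2 ss, cpath v0 A [seq (Max true, i) | i <- iota 0 n] [::] ss &
  last [::] ss = nest e e by apply/IH; exists e.
exists (ss ++ [:: nest (rcons e l) (rcons e l)]); last by rewrite last_cat cats1.
apply/cpath_cat; first exact: cpath_size h1.
split=> //; rewrite h2; split=> //=; rewrite add0n -en nest_rcons.
by apply/step_frame; eexists; [by [] | exists l].
Qed.

(** The minima are met from the innermost one outwards, and each equates the last labels of [e] and
    [e'] that remain. *)
Lemma mins_cpath n e e' : size e = n -> size e' = n ->
  (exists ss, cpath v0 A [seq (Min, i) | i <- rev (iota 0 n)] (nest e e') ss)
  <-> e = e'.
Proof.
elim: n e e' => [|n IH] e e'.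
  by case: e e' => [|? ?] [|? ?] // _ _; split=> // _; exists [::].
case/lastP: e => [|e l]; case/lastP: e' => [|e' l'] //.
rewrite !size_rcons => -[en] [en']; rewrite nest_rcons.
rewrite -(addn1 n) iotaD rev_cat map_cat /= add0n -en; split.
  case=> -[|t ss] //= [/step_frame[t2 -> [l1 E]]].
  have e1 : l = l1 := congr1 (head l) E.
  have e2 : opp l' = opp l1 := congr1 (nth l ^~ 1%N) E.
  have e3 : _ = t2 := congr1 (behead \o behead) E.
  rewrite -e3 (can_inj (@oppK H) e2) -e1 en => h; congr rcons.
  by apply/(IH _ _ en en'); exists ss.
move=> /rcons_inj[ee ell]; rewrite -ee -ell.
have [ss h] := proj2 (IH e e' en en') ee.
rewrite -ee -en in h; exists (nest e e :: ss); split=> //=.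
by apply/step_frame; eexists; [by [] | exists l].
Qed.

End Frames.
Lemma evalw_gen (X : choiceType) (R : word X -> word X -> Prop) w :
  evalw (gen R) w = cls R w.
Proof. by elim: w => [|[x e] w IH] //=; rewrite cls_cons IH. Qed.

(** * Action of braids on colorings *)

Section BraidColorings.
Variables (n : nat) (H : groupType).
Implicit Types (F : FM n -> H) (i : 'I_n.-1) (j : 'I_n).

(** A homomorphism [F] from [FM n] encodes labels for [n] strands, and a braid acts on it by
    precomposition with its automorphism. *)
Definition strand F j :=
  Label true (F (fx j) * (F (fu j))^-1) (F (fu j)) (F (fv j)).
Definition strands F := [seq strand F j | j <- enum 'I_n].

Definition label0 : label H := Label true 1 1 1.

Lemma size_strands F : size (strands F) = n.
Proof. by rewrite size_map size_enum_ord. Qed.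

Lemma nth_strands F j : nth label0 (strands F) j = strand F j.
Proof. by rewrite (nth_map j) ?size_enum_ord // nth_ord_enum. Qed.

Lemma step_strands (A : H -> Prop) c (F F' : FM n -> H) i :
  cross (F fv0) c (strand F' (lo i)) (strand F' (hi i)) =
    (strand F (lo i), strand F (hi i)) ->
  (forall j, j != lo i -> j != hi i -> strand F' j = strand F j) ->
  step (F fv0) A (Cross c) i (strands F') (strands F).
Proof.
move=> hc hj; apply: (@step_cross_nth _ _ _ _ _ _ _ label0); rewrite ?size_strands //.
- exact: ltn_ord (hi i).
- by rewrite -[nat_of_ord i]/(nat_of_ord (lo i)) -[_.+1]/(nat_of_ord (hi i)) !nth_strands.
- move=> j ji ji1; have [jn|jn] := ltnP j n; last by rewrite !nth_default ?size_strands.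
  by rewrite -[j]/(nat_of_ord (Ordinal jn)) !nth_strands hj // -val_eqE.
Qed.

Lemma uv_commute F (hF : {morph F : x y / x * y}) (g h : mgen n) :
  ~~ is_x g -> ~~ is_x h -> commute (F (gen _ g)) (F (gen _ h)).
Proof. by move=> gN hN; rewrite /commute -!hF; congr F; apply: gen_commute. Qed.

Lemma hi_lo i : (hi i == lo i) = false.
Proof. by apply/negbTE; rewrite eq_sym lo_hi. Qed.

(** With X = x u^-1, the automorphism of sigma_i sends X_{i+1} to X_i^{v0} and fixes X_i X_{i+1}.
    This is the rule of [Under] read from bottom to top, with [F] below the crossing. *)
Lemma step_sigma (A : H -> Prop) F i : {morph F : x y / x * y} ->
  step (F fv0) A (Cross Under) i
    (strands (fun y => F (phi_gen (Sigma i) y))) (strands F).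
Proof.
move=> hF; have FV := hom_inv hF; have comm := uv_commute hF.
have X j : phi_gen (Sigma i) (fx j) = sigma_img (lo i) (hi i) (Mx j) by apply: endo_x.
have U j : phi_gen (Sigma i) (fu j) = fu (tperm (lo i) (hi i) j) by apply: endo_u.
have V j : phi_gen (Sigma i) (fv j) = fv (tperm (lo i) (hi i) j) by apply: endo_v.
apply: step_strands => [|j ja jb]; rewrite /strand !X !U !V.
  rewrite /= !eqxx hi_lo tpermL tpermR /setx /=.
  have N := (commute_swaps (comm Mv0 (Mu (lo i)) isT isT),
    commute_swaps (comm Mv0 (Mu (hi i)) isT isT),
    commute_swaps (comm (Mu (lo i)) (Mu (hi i)) isT isT)).
  rewrite -/fv0 -/(fu _) -/(fu _) in N; rewrite !conjgE !(hF, FV).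
  move: (F fv0) (F (fu _)) (F (fu _)) (F (fx _)) (F (fx _)) N => v0 ua ub xa xb N.
  by congr (Label _ _ _ _, Label _ _ _ _); apply: (@mulgI _ xa);
    group_normalize; repeat (rewrite ?N; group_normalize).
by rewrite /= (negPf ja) (negPf jb) tpermD // eq_sym.
Qed.

(** Here X_i goes to X_{i+1} conjugated by v_i^-1, and X_{i+1} to X_i conjugated by v_{i+1}. *)
Lemma step_rho (A : H -> Prop) F i : {morph F : x y / x * y} ->
  step (F fv0) A (Cross Virtual) i
    (strands (fun y => F (phi_gen (Rho i) y))) (strands F).
Proof.
move=> hF; have FV := hom_inv hF; have comm := uv_commute hF.
have X j : phi_gen (Rho i) (fx j) = rho_img (lo i) (hi i) (Mx j) by apply: endo_x.
have U j : phi_gen (Rho i) (fu j) = fu (tperm (lo i) (hi i) j) by apply: endo_u.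
have V j : phi_gen (Rho i) (fv j) = fv (tperm (lo i) (hi i) j) by apply: endo_v.
apply: step_strands => [|j ja jb]; rewrite /strand !X !U !V.
  rewrite /= !eqxx hi_lo tpermL tpermR /setx /=.
  have N := (commute_swaps (comm (Mu (lo i)) (Mv (hi i)) isT isT),
    commute_swaps (comm (Mu (hi i)) (Mv (lo i)) isT isT)).
  rewrite -/(fu _) -/(fu _) -/(fv _) -/(fv _) in N; rewrite !conjgE !(hF, FV).
  move: (F (fu _)) (F (fu _)) (F (fv _)) (F (fv _)) (F (fx _)) (F (fx _)) N
    => ua ub va vb xa xb N.
  by congr (Label _ _ _ _, Label _ _ _ _); apply: (@mulgI _ xa);
    group_normalize; repeat (rewrite ?N; group_normalize).
by rewrite /= (negPf ja) (negPf jb) tpermD // eq_sym.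
Qed.

Lemma morph_aut F (f : aut (FM n)) : {morph F : x y / x * y} ->
  {morph (fun y => F (f y)) : x y / x * y}.
Proof. by move=> hF x y; rewrite aut_morph hF. Qed.

Lemma phi_gen_v0 (g : vbgen n) : phi_gen g fv0 = fv0.
Proof. by case: g => i; apply: endo_v0. Qed.

Lemma step_braid (A : H -> Prop) F (a : vbgen n * bool) : {morph F : x y / x * y} ->
  step (F fv0) A (braid_slice a).1 (braid_slice a).2
    (strands (fun y => F ((if a.2 then (phi_gen a.1)^-1 else phi_gen a.1) y)))
    (strands F).
Proof.
case: a => g [] hF; last by case: g => i; [apply: step_sigma | apply: step_rho].
(* For an inverse letter, the step of the generator from [F] to [F'] is turned upside down by
   [step_flip]. *)
pose F' y := F (((phi_gen g)^-1 : aut _) y).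
have hF' : {morph F' : x y / x * y} by apply: morph_aut.
have eF y : F' (phi_gen g y) = F y by rewrite /F' [_ (phi_gen g y)]aut_funK.
have F'0 : F' fv0 = F fv0 by rewrite -eF phi_gen_v0.
rewrite -F'0 -/F'.
have eS : strands F = strands (fun y => F' (phi_gen g y)).
  by apply: eq_map => j; rewrite /strand !eF.
rewrite eS; clearbody F'; move: hF'; clear.
by case: g => i hF'; [apply: (step_flip (c := Under)) | apply: (step_flip (c := Virtual))];
  [apply: step_sigma | apply: step_rho].
Qed.

Lemma word_aut_v0 (w : word (vbgen n)) : evalw (@phi_gen n) w fv0 = fv0.
Proof.
elim: w => [|[g e] w IH] //.
rewrite -[LHS]/(evalw (@phi_gen n) w ((if e then (phi_gen g)^-1 else phi_gen g) fv0)).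
have -> : (if e then (phi_gen g)^-1 else phi_gen g) fv0 = fv0; last exact: IH.
case: e; last exact: phi_gen_v0.
by rewrite -{1}(phi_gen_v0 g) [LHS]aut_funK.
Qed.

(** Automorphisms act on the right, so the first letter of [w], drawn at the top, is applied first
    to the generators and lies innermost in the composite with [F]. *)
Lemma cpath_braid (A : H -> Prop) F (w : word (vbgen n)) : {morph F : x y / x * y} ->
  exists2 ss, cpath (F fv0) A (map (@braid_slice n) w)
    (strands (fun y => F (evalw (@phi_gen n) w y))) ss &
    last (strands (fun y => F (evalw (@phi_gen n) w y))) ss = strands F.
Proof.
move=> hF; elim: w => [|a w [ss h1 h2]]; first by exists [::].
exists (strands (fun y => F (evalw (@phi_gen n) w y)) :: ss) => //; split=> //.
have := step_braid A a (morph_aut (evalw (@phi_gen n) w) hF).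
by rewrite word_aut_v0.
Qed.

End BraidColorings.

(** * Colorings of a closure as homomorphisms from [GM] *)

Section ClosureColorings.
Variables (n : nat) (w : word (vbgen n)).
Notation b := (cls (@vb_rel n) w).
Notation D := (closure_slices w).

(** The state below the maxima determines everything above it, where there is no minimum, and
    everything below it, where there is no maximum. *)
Lemma closure_cpath_uniq (H : groupType) (v0 : H) A B ss ss' :
  cpath v0 A D [::] ss -> cpath v0 B D [::] ss' ->
  last [::] (take n ss) = last [::] (take n ss') -> ss = ss'.
Proof.
case/cpath_split=> s1 [s2 [-> e1 h1 h2]] /cpath_split[t1 [t2 [-> f1 k1 k2]]].
rewrite size_map size_iota in e1 f1; rewrite !take_size_cat // => e.
have [|_ es] := cpath_codet _ h1 k1 e; first by rewrite all_map; apply/allP.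
rewrite -es; congr (_ ++ _); apply: cpath_det h2 _; last by rewrite es; exact: k2.
by rewrite all_cat !all_map; apply/andP; split; apply/allP => // -[[i|i] []].
Qed.

Section Evaluation.
Variables (H : groupType) (E : mgen n -> H).

Definition coords :=
  [seq Label true (E (Mx j) * (E (Mu j))^-1) (E (Mu j)) (E (Mv j)) | j <- enum 'I_n].

Definition respects_GM := forall l r, GM_rel b l r -> evalw E l = evalw E r.

Hypothesis uvE : forall g h, ~~ is_x g -> ~~ is_x h -> commute (E g) (E h).

Lemma uv_rel_eval l r : uv_rel l r -> evalw E l = evalw E r.
Proof.
case=> g h gN hN /=; rewrite mulg1.
by rewrite (uvE gN hN) mulKg mulVg.
Qed.

Definition evalF : FM n -> H := Defs.lift uv_rel_eval.

Lemma evalFM : {morph evalF : x y / x * y}. Proof. exact: gmulfM. Qed.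
Lemma evalF_gen g : evalF (gen _ g) = E g. Proof. exact: lift_gen. Qed.
Lemma evalF_cls l : evalF (cls _ l) = evalw E l. Proof. exact: lift_pi. Qed.

Lemma strands_evalF : strands evalF = coords.
Proof. by apply: eq_map => j; rewrite /strand /fx /fu /fv !evalF_gen. Qed.

Lemma phiM_cls : aut_fun (phiM b) = evalw (@phi_gen n) w.
Proof. by rewrite /phiM lift_pi. Qed.

(** It is enough to compare the two homomorphisms on generators. They always agree on v_0, which
    every braid automorphism fixes. *)
Lemma respects_GMP : respects_GM <->
  forall y, evalF (evalw (@phi_gen n) w y) = evalF y.
Proof.
rewrite -phiM_cls; split=> [hE|hE l r].
  have phiE g r : phiM b (gen _ g) = cls _ r -> GM_rel b (letter g) r ->
      evalF (phiM b (gen _ g)) = evalF (gen _ g).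
    by move=> e /hE; rewrite -!evalF_cls -e.
  apply: (hom_ext (f := fun y => evalF (phiM b y))) => [x y||[j|j||j]].
  - by rewrite aut_morph evalFM.
  - exact: evalFM.
  - by apply: (phiE _ _ (esym (clsK _))); apply: GM_x; rewrite clsK.
  - by apply: (phiE _ _ (esym (clsK _))); apply: GM_u; rewrite clsK.
  - by rewrite phiM_cls [X in evalF X](@word_aut_v0 n w).
  - by apply: (phiE _ _ (esym (clsK _))); apply: GM_v; rewrite clsK.
case=> [{}l {}r /uv_rel_eval //|j r' e|j r' e|j r' e]; rewrite -!evalF_cls -e hE.
all: by rewrite /fx /fu /fv.
Qed.

End Evaluation.

Lemma respects_uv (H : groupType) (E : mgen n -> H) : respects_GM E ->
  forall g h, ~~ is_x g -> ~~ is_x h -> commute (E g) (E h).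
Proof.
move=> hE g h gN hN; have := hE _ _ (GM_comm b (UV_comm gN hN)).
by rewrite /= mulg1 => e; apply/commgP/eqP.
Qed.

Lemma coloring_of_eval (H : groupType) (E : mgen n -> H) : respects_GM E ->
  exists A ss, coloring D (E Mv0) A ss /\ last [::] (take n ss) = nest (coords E) (coords E).
Proof.
move=> hE; have uvE := respects_uv hE.
have hF := proj1 (respects_GMP uvE) hE.
pose A h := exists2 g, ~~ is_x g & h = E g.
have sz : size (coords E) = n by rewrite size_map size_enum_ord.
have [s1 h1 e1] : exists2 ss, cpath (E Mv0) A [seq (Max true, i) | i <- iota 0 n] [::] ss &
    last [::] ss = nest (coords E) (coords E).
  apply/maxs_cpathP; exists (coords E); split=> //; first by rewrite all_map; apply/allP.
  apply/okP => l /List.in_map_iff[j [<- _]] /=.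
  by split; [exists (Mu j) | exists (Mv j)].
have [s2 h2 e2] := cpath_braid A w (evalFM uvE).
(* The relations of [GM b] make the states above and below the braid equal, so that the minima can
   close the strands. *)
have eS : strands (fun y => evalF uvE (evalw (@phi_gen n) w y)) = coords E.
  by rewrite -(strands_evalF uvE); apply: eq_map => j; rewrite /strand !hF.
rewrite eS strands_evalF evalF_gen in h2 e2.
have [s3 h3] := proj2 (mins_cpath (E Mv0) A sz sz) erefl.
exists A, (s1 ++ map (cat^~ (rev (map (@opp H) (coords E)))) s2 ++ s3).
have szs1 : size s1 = n by rewrite (cpath_size h1) size_map size_iota.
rewrite take_size_cat //; split=> //; split.
  split; first by exists Mv0.
  by move=> _ _ [g gN ->] [h hN ->]; apply: (uvE).
apply/cpath_cat; first by rewrite size_map size_iota.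
rewrite e1; split=> //; apply/cpath_cat; first exact: etrans (size_map _ _) (cpath_size h2).
rewrite (last_map (cat^~ _)) e2; split=> //; apply: cpath_catr h2.
by rewrite all_map; apply/allP => -[[i|i] []].
Qed.

(** The values of [E] are read off the state below the maxima, with x recovered as X u. *)
Lemma eval_of_coloring (H : groupType) (v0 : H) A ss : coloring D v0 A ss ->
  exists E : mgen n -> H, [/\ E Mv0 = v0, respects_GM E &
    last [::] (take n ss) = nest (coords E) (coords E)].
Proof.
case=> [[A0 AC] /cpath_split[s1 [s4 [-> e1 h1 /cpath_split[s2 [s3 [-> e2 h2 h3]]]]]]].
rewrite size_map size_iota in e1; rewrite take_size_cat //.
have [e [sz hdn oke eS]] := proj1 (maxs_cpathP v0 A n (last [::] s1)) (ex_intro2 _ _ _ h1 erefl).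
pose l j := nth (label0 H) e j.
pose E (g : mgen n) := match g with
  | Mx j => lx (l j) * lu (l j) | Mu j => lu (l j) | Mv0 => v0 | Mv j => lv (l j) end.
have eE : coords E = e.
  rewrite -[RHS](mkseq_nth (label0 H)) sz /mkseq -val_enum_ord -map_comp.
  apply: eq_map => j /=; rewrite mulgK -/(l j).
  have : dn (l j) by apply: (all_nthP (label0 H) hdn); rewrite sz.
  by case: (l j) => /= o x u v ->.
have okE g : ~~ is_x g -> A (E g).
  have okl (j : 'I_n) : admissible A (l j).
    apply: (proj1 (okP A e) oke); rewrite /l; have: j < size e by rewrite sz.
    elim: (e) (nat_of_ord j) => [|a e' IH] [|i] //= ie; first by left.
    by right; apply: IH.
  by case: g => [j|j||j] //= _; case: (okl j).
have uvE g h : ~~ is_x g -> ~~ is_x h -> commute (E g) (E h).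
  by move=> /okE gA /okE hA; apply: AC.
exists E; split=> //; last by rewrite eE.
apply/(respects_GMP uvE).
pose phi : aut (FM n) := evalw (@phi_gen n) w.
(* Since [F'] after [phi] is [evalF], the labels [e] above the braid force the state [strands F']
   below it. The minima identify this state with [e], whence [F'] and [evalF] agree. *)
pose F' y := evalF uvE (phi^-1 y).
have hF' : {morph F' : x y / x * y} by apply: (morph_aut phi^-1 (evalFM uvE)).
have F'phi y : F' (phi y) = evalF uvE y by rewrite /F' [_ (phi y)]aut_funK.
have F'0 : F' fv0 = v0.
  by rewrite -[in LHS](@word_aut_v0 n w) F'phi evalF_gen.
have [t2] := cpath_braid A w hF'; rewrite F'0.
have -> : strands (fun y => F' (evalw (@phi_gen n) w y)) = e.
  by rewrite -eE -(strands_evalF uvE); apply: eq_map => j; rewrite /strand !F'phi.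
have noMax : all (fun e : slice => ~~ is_max e.1) (map (@braid_slice n) w).
  by rewrite all_map; apply/allP => -[[i|i] []].
move=> /(cpath_catr (rev (map (@opp H) e)) noMax) k2 ek2.
rewrite eS in h2 h3; have es2 := cpath_det noMax h2 k2.
rewrite es2 (last_map (cat^~ _)) ek2 in h3.
have szF' : size (strands F') = n by rewrite size_strands.
have eF' := proj1 (mins_cpath v0 A szF' sz) (ex_intro _ _ h3).
have eF'j j : strand F' j = strand (evalF uvE) j.
  by rewrite -!nth_strands eF' strands_evalF eE.
have F'E : F' =1 evalF uvE.
  apply: hom_ext; [exact: hF' | exact: evalFM | case=> [j|j||j]].
  - have := eF'j j; rewrite /strand => -[/[swap] -> /mulIg + _]; exact.
  - by have := eF'j j; rewrite /strand => -[].
  - by rewrite evalF_gen.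
  - by have := eF'j j; rewrite /strand => -[].
by move=> y; rewrite -F'E F'phi.
Qed.

Lemma lmap_coords (H K : groupType) (f : {multiplicative H -> K}) (E : mgen n -> H) :
  map (lmap f) (coords E) = coords (f \o E).
Proof.
rewrite -map_comp; apply: eq_map => j.
by rewrite /lmap /= gmulfM (hom_inv (@gmulfM _ _ f)).
Qed.

Lemma coords_inj (H : groupType) (E E' : mgen n -> H) :
  coords E = coords E' -> E Mv0 = E' Mv0 -> E =1 E'.
Proof.
move/eq_in_map=> h h0; case=> [j|j||j] //; have [] := h j (mem_enum _ _).
- by move=> /[swap] -> /mulIg.
- by [].
- by [].
Qed.

Lemma nest_inj (H : groupType) (e e' : seq (label H)) :
  size e = size e' -> nest e e = nest e' e' -> e = e'.
Proof. by move=> se h; have := congr1 (take (size e)) h; rewrite {2}se !take_size_cat. Qed.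

Lemma lmap_nest (H K : groupType) (f : {multiplicative H -> K}) e e' :
  map (lmap f) (nest e e') = nest (map (lmap f) e) (map (lmap f) e').
Proof.
rewrite /nest map_cat map_rev; congr (_ ++ rev _).
by rewrite -!map_comp; apply: eq_map => l; rewrite /= lmap_opp.
Qed.

Lemma size_coords (H : groupType) (E : mgen n -> H) : size (coords E) = n.
Proof. by rewrite size_map size_enum_ord. Qed.

(** The generators of [GM b] give the tautological coloring. Any other coloring is determined by its
    state below the maxima, which prescribes the images of the generators. *)
Lemma closure_presents : presents D (GM b).
Proof.
pose E0 : mgen n -> GM b := gen (GM_rel b).
have hE0 : respects_GM E0.
  by move=> l r lr; rewrite /E0 !evalw_gen; apply: pi_rel.
have [A [c [cc ec]]] := coloring_of_eval hE0.
exists (E0 Mv0), A, c; split=> // H v0 B c' cc'.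
have [E [Ev0 hE ec']] := eval_of_coloring cc'.
pose f : {multiplicative GM b -> H} := Defs.lift hE.
have fE g : f (E0 g) = E g by apply: lift_gen.
have last_lmap (g : {multiplicative GM b -> H}) :
    last [::] (take n (map (map (lmap g)) c)) = nest (coords (g \o E0)) (coords (g \o E0)).
  by rewrite -map_take (last_map (map (lmap g)) _ [::]) ec lmap_nest lmap_coords.
exists f; split.
- by rewrite fE.
- apply: (closure_cpath_uniq (v0 := v0) (A := fun _ => True) (B := B)).
  + by rewrite -Ev0 -fE; case: cc => _ /(@cpath_lmap _ _ f _ _ (fun _ => True)); apply.
  + by case: cc'.
  + by rewrite last_lmap ec'; congr (nest _ _); apply: eq_map => j /=; rewrite !fE.
- move=> g g0 gc.
  have eg : coords (g \o E0) = coords (f \o E0).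
    apply: nest_inj; first by rewrite !size_coords.
    rewrite -!last_lmap gc ec' last_lmap.
    by congr (nest _ _); apply: eq_map => j /=; rewrite !fE.
  have := coords_inj eg; rewrite /= g0 fE Ev0 => /(_ erefl) h.
  by apply: hom_ext => [||y]; [exact: gmulfM | exact: gmulfM | symmetry; exact: h].
Qed.

End ClosureColorings.

Theorem theorem3 (n m : nat) (hn : 2 <= n) (hm : 2 <= m)
  (b : VB n) (b' : VB m) :
  braid_closure b = braid_closure b' -> group_isomorphic (GM b) (GM b').
Proof.
rewrite -(clsK b) -(clsK b') !braid_closureE => hL.
apply: presents_iso (closure_presents _).
exact: (presents_link hL (closure_presents _)).
Qed.
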